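(* Let $f\in\mathbb{R}^q$ and let $W$ be a linear subspace of $\mathbb{R}^q$ such that $f+W$ contains a point of $\mathbb{Z}^q$. Let $\mathcal{B}_W$ be the family of all maximal lattice-free convex sets of $f+W$ with $f$ in their interior (relative to $f+W$). Then the closure of $\mathrm{conv}(R_f(W))$ in $\mathcal{W}$ with respect to the norm $\|\cdot\|_H$ equals $$\Big\{s\in\mathcal{V} : \sum_{r\in W}\psi_B(r)s_r\ge 1\ \text{for all } B\in\mathcal{B}_W,\ \ s_r\ge 0\ \text{for all } r\in W\Big\}.$$
   Context: Setting: $f\in\mathbb{R}^q$, $W\subseteq\mathbb{R}^q$ is a linear subspace, and $(f+W)\cap\mathbb{Z}^q\neq\emptyset$. $\mathcal{W}$ is the vector space of all $s=(s_r)_{r\in W}\in\mathbb{R}^W$ with finite support (i.e. $\{r\in W: s_r\neq 0\}$ is finite), endowed with the norm $$\|s\|_H=|s_0|+\sum_{r\in W\setminus\{0\}}\|r\|\,|s_r|,$$ where $\|r\|$ is the Euclidean norm. $R_f(W)$ is the set of $s\in\mathcal{W}$ such that $s_r\ge0$ for all $r\in W$ and $f+\sum_{r\in W}rs_r\in\mathbb{Z}^q$. $V$ is the affine hull of $(f+W)\cap\mathbb{Z}^q$ and $\mathcal{V}=\{s\in\mathcal{W}: f+\sum_{r\in W}rs_r\in V\}$. A set $B$ is a maximal lattice-free convex set of $f+W$ if $B\subseteq f+W$, $B$ is convex, $B$ has no integral point in its interior relative to $f+W$, and $B$ is inclusionwise maximal with these properties. Such a $B$ with $f$ in its interior is known to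 be a polyhedron, so it can be written irredundantly (one inequality per facet) as $B=\{x\in f+W : a_i(x-f)\le 1,\ i=1,\dots,t\}$ with $a_1,\dots,a_t\in\mathbb{R}^q$; then $\psi_B:W\to\mathbb{R}$ is defined by $\psi_B(r)=\max_{i=1,\dots,t}a_ir$. *)

(* Defs.v *)
From HB Require Import structures.
From mathcomp Require Import all_boot all_order all_algebra.
From mathcomp Require Import all_classical all_reals all_analysis.

Set Implicit Arguments.
Unset Strict Implicit.
Unset Printing Implicit Defensive.

Import Order.TTheory GRing.Theory Num.Theory.
Import numFieldNormedType.Exports.

Local Open Scope classical_set_scope.
Local Open Scope ring_scope.

Section Euclidean.
Context {R : realType} {q : nat}.
Implicit Types x y : 'rV[R]_q.

Definition dot x y : R := \sum_(i < q) x 0 i * y 0 i.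

(* The library norm on 'rV[R]_q is the sup norm. *)
Definition enorm x : R := Num.sqrt (dot x x).

Lemma enorm_ge0 x : 0 <= enorm x.
Proof. exact: sqrtr_ge0. Qed.

Lemma enorm_eq0 x : enorm x = 0 -> x = 0.
Proof.
move=> /eqP; rewrite sqrtr_eq0 => x0.
have p i : true -> 0 <= x 0 i * x 0 i by rewrite -expr2 sqr_ge0.
have /eqP : dot x x = 0 by apply/eqP; rewrite eq_le x0 sumr_ge0.
rewrite psumr_eq0// => /allP xx; apply/rowP => i; rewrite mxE.
by have := xx i (mem_index_enum _); rewrite mulf_eq0 orbb => /eqP.
Qed.

Definition integer_points : set 'rV[R]_q := [set x | x \is a mxOver Num.int].

Definition affine_set (A : set 'rV[R]_q) : Prop :=
  forall x y (l : R), A x -> A y -> A (l *: x + (1 - l) *: y).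

Definition affine_hull (A : set 'rV[R]_q) : set 'rV[R]_q :=
  smallest affine_set A.

End Euclidean.

Definition convex_hull (R : realType) (M : lmodType R) (A : set M) : set M :=
  smallest (@convex_set R M) A.

(* The space of finitely supported s : W -> R. Vectors of W are elements of
   the type subvs_of W, and vsval : subvs_of W -> 'rV[R]_q is the inclusion. *)
Section FinSupp.
Context {R : realType} {q : nat} (W : {vspace 'rV[R]_q}).

Definition fin_supp : {pred subvs_of W -> R} :=
  fun s => `[< finite_set [set r | s r != 0] >].

Record finsupp_fun := FinsuppFun {
  coef :> subvs_of W -> R ;
  coef_fin_supp : coef \in fin_supp }.

HB.instance Definition _ := [isSub for coef].
HB.instance Definition _ := [Choice of finsupp_fun by <:].

Lemma fin_suppP (s : subvs_of W -> R) :
  (s \in fin_supp) <-> finite_set [set r | s r != 0].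
Proof. by split=> [/asboolP|h]; last exact/asboolP. Qed.

Lemma fin_supp_submod_closed : submod_closed fin_supp.
Proof.
split=> [|a s t /fin_suppP fs /fin_suppP ft]; apply/fin_suppP.
  by rewrite [X in finite_set X](_ : _ = set0)// -subset0 => r /=; rewrite eqxx.
have fst : finite_set ([set r | s r != 0] `|` [set r | t r != 0]).
  by rewrite finite_setU.
apply: sub_finite_set fst => r /= str.
apply: contrapT => /not_orP[] /negP/negPn/eqP s0 /negP/negPn/eqP t0.
move: str => /eqP; apply.
by rewrite [LHS](_ : _ = a * s r + t r)// s0 t0 mulr0 addr0.
Qed.

HB.instance Definition _ :=
  GRing.isSubmodClosed.Build _ _ fin_supp fin_supp_submod_closed.
HB.instance Definition _ := [SubChoice_isSubLmodule of finsupp_fun by <:].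

Implicit Types s t : finsupp_fun.

Definition normH s : R :=
  `|s 0| + \sum_(r \in [set~ (0 : subvs_of W)]) enorm (vsval r) * `|s r|.

Let normH_widen s (D : set (subvs_of W)) : finite_set D ->
  [set r | s r != 0] `<=` D ->
  normH s = `|s 0| + \sum_(r \in D `\ 0) enorm (vsval r) * `|s r|.
Proof.
move=> fD sD; congr (_ + _); apply/esym/fsbig_widen.
  by move=> r [].
move=> r /= [r0 Dr].
have sr0 : s r = 0.
  apply/eqP/negPn/negP => sr; apply: Dr; split; first exact: sD.
  exact: r0.
by rewrite sr0 normr0 mulr0.
Qed.

Let finD s : finite_set [set r | s r != 0].
Proof. exact/fin_suppP/coef_fin_supp. Qed.

Lemma normH_triangle s t : normH (s + t) <= normH s + normH t.
Proof.
pose D := [set r | s r != 0] `|` [set r | t r != 0].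
have fD : finite_set D by rewrite finite_setU; split; exact: finD.
have fD0 : finite_set (D `\ 0) by exact: finite_setD.
rewrite (normH_widen (s := s) fD); last by move=> r; left.
rewrite (normH_widen (s := t) fD); last by move=> r; right.
have stE r : (s + t) r = s r + t r by [].
rewrite (normH_widen (s := s + t) fD); last first.
  move=> r str; apply: contrapT => /not_orP[].
  move=> /negP/negPn/eqP s0 /negP/negPn/eqP t0.
  have /eqP[] : s r + t r != 0 := str.
  by rewrite s0 t0 addr0.
rewrite addrACA; apply: lerD; first by rewrite stE ler_normD.
rewrite -fsbig_split//.
rewrite !fsbig_finite//; apply: ler_sum => r _.
have := ler_wpM2l (enorm_ge0 (vsval r)) (ler_normD (s r) (t r)).
by rewrite mulrDr -stE.
Qed.

Lemma normHZ (l : R) s : normH (l *: s) = `|l| * normH s.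
Proof.
have lsE r : (l *: s) r = l * s r by [].
rewrite /normH lsE normrM mulrDr mulr_fsumr; congr (_ + _).
by apply: eq_fsbigr => r _; rewrite lsE normrM mulrCA.
Qed.

Lemma normH_eq0 s : normH s = 0 -> s = 0.
Proof.
have fD0 : finite_set ([set r | s r != 0] `\ 0) by apply: finite_setD.
have p r : ([set r | s r != 0] `\ 0) r -> 0 <= enorm (vsval r) * `|s r|.
  by move=> _; rewrite mulr_ge0 ?enorm_ge0.
rewrite (normH_widen (finD s))// => /eqP.
rewrite paddr_eq0 ?fsumr_ge0// normr_eq0 => /andP[/eqP s0 /eqP /pfsumr_eq0].
move=> /(_ fD0 p) sr0; apply/val_inj/funext => r /=.
have [->//|r0] := eqVneq r 0.
apply/eqP/negPn/negP => sr.
have /eqP := sr0 r (conj sr (elimN eqP r0)).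
rewrite mulf_eq0 normr_eq0 (negPf sr) orbF => /eqP/enorm_eq0 vr0.
by move/eqP: r0; apply; exact: val_inj.
Qed.

HB.instance Definition _ := Lmodule_isNormed.Build R finsupp_fun
  normH_triangle normHZ normH_eq0.

Lemma finsupp_normE s : `|s| = normH s.
Proof. by []. Qed.

End FinSupp.

Section Relaxation.
Context {R : realType} {q : nat} (f : 'rV[R]_q) (W : {vspace 'rV[R]_q}).

Definition translate : set 'rV[R]_q := [set f + w | w in [set` W]].

Definition endpoint (s : finsupp_fun W) : 'rV[R]_q :=
  f + \sum_(r \in [set: subvs_of W]) s r *: vsval r.

Definition Rf : set (finsupp_fun W) :=
  [set s : finsupp_fun W | (forall r, 0 <= s r) /\ integer_points (endpoint s)].

Definition Vaff : set 'rV[R]_q := affine_hull (translate `&` integer_points).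

Definition Vcal : set (finsupp_fun W) := [set s : finsupp_fun W | Vaff (endpoint s)].

(* In the subspace topology of translate the points outside translate are
   isolated; this is harmless below, where B is contained in translate. *)
Definition rel_interior (B : set 'rV[R]_q) : set 'rV[R]_q :=
  (B : set (subspace translate))^°.

Definition lattice_free_convex (B : set 'rV[R]_q) : Prop :=
  [/\ B `<=` translate, convex_set B
    & rel_interior B `&` integer_points = set0].

Definition maximal_lattice_free (B : set 'rV[R]_q) : Prop :=
  lattice_free_convex B /\
  forall C, lattice_free_convex C -> B `<=` C -> C = B.

Definition BW : set (set 'rV[R]_q) :=
  [set B | maximal_lattice_free B /\ rel_interior B f].

Definition halfspaces (t : nat) (a : 'I_t -> 'rV[R]_q) (P : pred 'I_t) :
    set 'rV[R]_q :=
  [set x | translate x /\ forall i, P i -> dot (a i) (x - f) <= 1].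

Definition irredundant_repr (B : set 'rV[R]_q) (t : nat)
    (a : 'I_t -> 'rV[R]_q) : Prop :=
  B = halfspaces a predT /\ forall j, halfspaces a (predC1 j) <> B.

Definition max_form (t : nat) (a : 'I_t.+1 -> 'rV[R]_q) (r : subvs_of W) : R :=
  \big[Num.max/dot (a ord0) (vsval r)]_(i < t.+1) dot (a i) (vsval r).

(* Every B in BW is a polyhedron with an irredundant description; t = 0
   inequalities cannot occur, since translate is not lattice-free. The
   restrictions of the a_i to W are determined by B up to order, so psi B does
   not depend on the choice. The default value 0 is used only when B has no
   such description. *)
Definition psi (B : set 'rV[R]_q) : subvs_of W -> R :=
  xget (fun=> 0) [set p | exists (t : nat) (a : 'I_t.+1 -> 'rV[R]_q),
    irredundant_repr B a /\ p = max_form a].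

End Relaxation.

Arguments endpoint {R q} f {W} s.
Arguments Rf {R q} f W _.
Arguments Vcal {R q} f W _.
Arguments BW {R q} f W _.
Arguments psi {R q} f W B r.

(* Main.v *)
(** Hahn-Banach separates a point [s] outside the closed convex hull from [Rf] by
    a linear functional [l] on the space of finitely supported functions. Taking
    for each [r] the infimum of [l t] over all [t >= 0] with [\sum_r t_r r = r]
    turns [l] into a sublinear function [p] on [W] that is at least some [a] on
    the lattice points (shifted by [-f]), whereas [\sum_r p(r) s_r < a]. The
    directions of the affine hull of the lattice points can be followed forever
    at bounded distance from the lattice, so [p >= 0] on them; a second use of
    Hahn-Banach then yields a linear functional, vanishing on these directions,
    whose subtraction makes [p] nonnegative on [W] without affecting the
    inequality on [Vcal]. After scaling to [a = 1], the set [p <= 1] is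
    lattice-free, by Zorn it is contained in a set [B] of [BW], and
    [psi B <= p] cuts off [s].

    For the converse inclusion one has to know that the sets of [BW] are
    polyhedra. Since [Z^q] has [2^q] parity classes, a Helly-type argument shows
    that [2^q] half-spaces containing [B] suffice to exclude all lattice points
    of a given box; letting the box grow, a compactness argument gives a
    lattice-free polyhedron containing [B], hence equal to [B]. *)
From HB Require Import structures.
Require Import Defs.
From mathcomp Require Import all_boot all_order all_algebra.
From mathcomp Require Import all_classical all_reals all_analysis.
From mathcomp Require Import finmap zify ring lra.
Set Implicit Arguments.
Unset Strict Implicit.
Unset Printing Implicit Defensive.
Import Order.TTheory GRing.Theory Num.Theory.
Import numFieldNormedType.Exports.
Local Open Scope classical_set_scope.
Local Open Scope ring_scope.

(** * Sublinear functions and the Hahn-Banach theorem *)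

Section Sublinear.
Context {R : realType} {M : lmodType R}.
Implicit Types (p : M -> R) (x y z : M).

Definition sublinear p : Prop :=
  (forall x y, p (x + y) <= p x + p y) /\
  (forall t x, 0 <= t -> p (t *: x) = t * p x).

Lemma sublinear0 p : sublinear p -> p 0 = 0.
Proof. by move=> [_ pZ]; rewrite -(scale0r 0) pZ// mul0r. Qed.

Section Epigraph.
Variable E : M -> R -> Prop.
Hypothesis ED : forall x y c d, E x c -> E y d -> E (x + y) (c + d).
Hypothesis EZ : forall t x c, 0 < t -> E x c -> E (t *: x) (t * c).
Hypothesis Eex : forall x, exists c, E x c.
Hypothesis E0 : forall c, E 0 c -> 0 <= c.

(** [E] is a convex cone of pairs and [epi_inf] its lower envelope; a point of [E] above [- x],
    together with [E0], bounds it below at [x]. Slid functions, infima of chains, gauges and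
    certificates are all obtained in this way. *)
Definition epi_inf x : R := inf [set c | E x c].

Let Elb x : has_lbound [set c | E x c].
Proof.
have [d Ed] := Eex (- x); exists (- d) => c /= Ec.
rewrite -subr_ge0 opprK; apply: E0.
by rewrite -(subrr x); exact: ED.
Qed.

Lemma epi_inf_le x c : E x c -> epi_inf x <= c.
Proof. by move=> Ec; apply: ge_inf. Qed.

Lemma le_epi_inf x b : (forall c, E x c -> b <= c) -> b <= epi_inf x.
Proof. by move=> bE; apply: lb_le_inf => //; have [c] := Eex x; exists c. Qed.

Lemma epi_inf_sublinear : sublinear epi_inf.
Proof.
have le t x : 0 < t -> t * epi_inf x <= epi_inf (t *: x).
  move=> t0; apply: le_epi_inf => c Ec.
  rewrite mulrC -ler_pdivlMr//; apply: epi_inf_le.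
  have := EZ (t := t^-1) _ Ec.
  by rewrite invr_gt0 scalerK ?gt_eqF// mulrC; exact.
have e0 : epi_inf 0 = 0.
  apply/eqP; rewrite eq_le le_epi_inf ?andbT; last exact: E0.
  (* Scaling by 2 fixes 0, so [2 * epi_inf 0 <= epi_inf 0]. *)
  by have := @le 2 0; rewrite scaler0 ltr0n => /(_ isT); lra.
split=> [x y|t x].
  rewrite -lerBlDr; apply: le_epi_inf => c Ec.
  rewrite lerBlDr -lerBlDl; apply: le_epi_inf => d Ed.
  by rewrite lerBlDl; apply: epi_inf_le; exact: ED.
rewrite le_eqVlt => /predU1P[<-|t0]; first by rewrite scale0r mul0r.
apply/eqP; rewrite eq_le le// andbT.
have := le t^-1 (t *: x); rewrite invr_gt0 scalerK ?gt_eqF// => /(_ t0).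
by rewrite mulrC ler_pdivrMr// mulrC.
Qed.

End Epigraph.

(* Take for [p' x] the infimum of [p (x + t z) - t p z] over [t >= 0]. *)
Lemma sublinear_slide p z : sublinear p ->
  exists p', [/\ sublinear p', (forall x, p' x <= p x)
    & (forall x, p' x <= p (x + z) - p z)].
Proof.
move=> ps; have [pD pZ] := ps.
pose E x c := exists2 t, 0 <= t & p (x + t *: z) - t * p z <= c.
have ED x y c d : E x c -> E y d -> E (x + y) (c + d).
  move=> [t t0 tc] [u u0 uc]; exists (t + u); first exact: addr_ge0.
  have := pD (x + t *: z) (y + u *: z).
  by rewrite addrACA -scalerDl mulrDl; lra.
have EZ t x c : 0 < t -> E x c -> E (t *: x) (t * c).
  move=> t0 [u u0 uc]; exists (t * u); first by rewrite mulr_ge0// ltW.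
  by rewrite -scalerA -scalerDr pZ ?(ltW t0)// -mulrA -mulrBr ler_pM2l.
have Eex x : exists c, E x c by exists (p (x + 0 *: z) - 0 * p z), 0.
have E0 c : E 0 c -> 0 <= c.
  by move=> [t t0]; rewrite add0r pZ// subrr.
exists (epi_inf E); split; first exact: epi_inf_sublinear.
  move=> x; apply: epi_inf_le => //; exists 0 => //.
  by rewrite scale0r addr0 mul0r subr0.
move=> x; apply: epi_inf_le => //; exists 1 => //.
by rewrite scale1r mul1r.
Qed.

Lemma sublinear_minimal p : sublinear p ->
  exists2 m, sublinear m & (forall x, m x <= p x) /\
    forall m', sublinear m' -> (forall x, m' x <= m x) -> m' = m.
Proof.
move=> ps.
pose T := {m : M -> R | sublinear m /\ forall x, m x <= p x}.
pose rT (m m' : T) := `[< forall x, sval m' x <= sval m x >].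
(* [rT] reverses the pointwise order, so its maximal elements are minimal functions. *)
have [|||A Atot|m mmin] := @Zorn T rT.
- by move=> m; apply/asboolP.
- move=> m1 m2 m3 /asboolP h12 /asboolP h23; apply/asboolP => x.
  exact: le_trans (h12 x).
- move=> [m hm] [m' hm'] /asboolP/= h /asboolP/= h'; apply: eq_exist.
  by apply/funext => x; apply/eqP; rewrite eq_le h h'.
- have [[m0 Am0]|] := pselect (A !=set0); last first.
    move=> An; exists (exist _ p (conj ps (fun=> lexx _)) : T) => m Am.
    by case: An; exists m.
  (* The pointwise infimum of the chain. It is subadditive because the smaller of two members serves
     for both arguments. *)
  pose E x c := exists2 m, A m & sval m x <= c.
  have ED x y c d : E x c -> E y d -> E (x + y) (c + d).
    move=> [m Am mc] [m' Am' md].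
    have [/asboolP h|/asboolP h] := Atot _ _ Am Am'.
      exists m' => //; have := (svalP m').1.1 x y; have := h x; lra.
    by exists m => //; have := (svalP m).1.1 x y; have := h y; lra.
  have EZ t x c : 0 < t -> E x c -> E (t *: x) (t * c).
    move=> t0 [m Am mc]; exists m => //.
    by rewrite (svalP m).1.2 ?(ltW t0)// ler_pM2l.
  have Eex x : exists c, E x c by exists (sval m0 x), m0.
  have E0 c : E 0 c -> 0 <= c.
    by move=> [m Am]; rewrite (sublinear0 (svalP m).1).
  have Ele m x : A m -> epi_inf E x <= sval m x.
    by move=> Am; apply: epi_inf_le => //; exists m.
  have Ep : sublinear (epi_inf E) /\ forall x, epi_inf E x <= p x.
    split; first exact: epi_inf_sublinear.
    by move=> x; apply: le_trans (Ele _ _ Am0) _; exact: (svalP m0).2.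
  exists (exist _ (epi_inf E) Ep : T) => m Am; apply/asboolP => x.
  exact: Ele.
- case: m mmin => m [ms mp] mmin; exists m => //; split => // m' m's m'm.
  have m'p : sublinear m' /\ forall x, m' x <= p x.
    by split=> // x; apply: le_trans (m'm x) (mp x).
  have /mmin/(congr1 sval) : rT (exist _ m (conj ms mp)) (exist _ m' m'p : T).
    exact/asboolP.
  by [].
Qed.

Lemma hahn_banach p z : sublinear p ->
  exists phi : {scalar M}, (forall x, phi x <= p x) /\ phi z = p z.
Proof.
(* After sliding along [z], [p1 (- z) <= - p z]; hence every linear function below [p1] takes the
   value [p z] at [z]. *)
move=> ps; have [p1 [p1s p1p p1z]] := sublinear_slide z ps.
have [m ms [mp1 mmin]] := sublinear_minimal p1s.
(* A minimal sublinear [m] is linear: sliding it along [y] does not decrease it,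
   so [m x <= m (x + y) - m y]. *)
have mD x y : m (x + y) = m x + m y.
  apply/eqP; rewrite eq_le ms.1/=.
  have [m' [m's m'm m'y]] := sublinear_slide y ms.
  by have := m'y x; rewrite (mmin _ m's m'm) -lerBrDr; lra.
have mN x : m (- x) = - m x.
  by apply/eqP; rewrite -addr_eq0 -mD addNr (sublinear0 ms).
have mlin : linear_for *%R m.
  move=> a x y; rewrite mD; congr (_ + _).
  have [a0|a0] := lerP 0 a; first by rewrite ms.2.
  rewrite -[LHS]opprK -mN -scaleNr ms.2 ?oppr_ge0 ?(ltW a0)//.
  by rewrite mulNr opprK.
pose phi : {scalar M} := HB.pack m (GRing.isLinear.Build R M R *%R m mlin).
exists phi; split=> [x|]; first exact: le_trans (p1p x).
apply/eqP; rewrite eq_le (le_trans (mp1 z) (p1p z))/=.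
have := p1z (- z); rewrite addNr (sublinear0 ps); have := mp1 (- z).
by rewrite mN /phi/=; lra.
Qed.

(** Hahn-Banach for the Minkowski gauge of [K], here [epi_inf E]: the gauge is at most 1 on [K], and
    the last hypothesis makes it at least 1 at [z]. *)
Lemma gauge_separation (K : set M) z :
  (forall x y (t : R), K x -> K y -> 0 <= t -> t <= 1 ->
     K (t *: x + (1 - t) *: y)) ->
  (forall x, exists c : R, 0 < c /\ K (c *: x)) ->
  (forall c, 1 < c -> ~ K (c *: z)) ->
  exists phi : {scalar M}, (forall x, K x -> phi x <= 1) /\ 1 <= phi z.
Proof.
move=> Kc Kabs Kz.
pose E x (c : R) := 0 < c /\ K (c^-1 *: x).
have ED x y c d : E x c -> E y d -> E (x + y) (c + d).
  move=> [c0 Kx] [d0 Ky]; have cd0 := addr_gt0 c0 d0; split => //.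
  have := Kc _ _ (c / (c + d)) Kx Ky.
  have -> : (c / (c + d)) *: (c^-1 *: x) + (1 - c / (c + d)) *: (d^-1 *: y) =
      (c + d)^-1 *: (x + y).
    rewrite scalerDr !scalerA; congr (_ *: _ + _ *: _).
      by rewrite mulrAC divff ?mul1r ?gt_eqF.
    by field; rewrite ?gt_eqF.
  apply; first by rewrite divr_ge0 ?ltW.
  by rewrite ler_pdivrMr// mul1r lerDl ltW.
have EZ t x c : 0 < t -> E x c -> E (t *: x) (t * c).
  move=> t0 [c0 Kx]; split; first exact: mulr_gt0.
  by rewrite scalerA invfM mulrAC mulVf ?mul1r ?gt_eqF.
have Eex x : exists c, E x c.
  have [c [c0 Kx]] := Kabs x; exists c^-1; split; first by rewrite invr_gt0.
  by rewrite invrK.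
have E0 c : E 0 c -> 0 <= c by move=> [/ltW].
have [phi [phip phiz]] := hahn_banach z (epi_inf_sublinear ED EZ Eex E0).
exists phi; split=> [x Kx|].
  apply: le_trans (phip x) _; apply: epi_inf_le => //.
  by split=> //; rewrite invr1 scale1r.
rewrite phiz; apply: le_epi_inf => // c [c0 Kcz].
rewrite leNgt; apply/negP => c1; apply: (Kz c^-1) => //.
by rewrite invf_gt1.
Qed.

End Sublinear.

(** * Helly's theorem for lattice points *)

Section Dot.
Context {R : realType} {q : nat}.
Implicit Types (a x y : 'rV[R]_q).

Lemma dotDr a x y : dot a (x + y) = dot a x + dot a y.
Proof.
rewrite /dot -big_split; apply: eq_bigr => i _ /=.
by rewrite mxE mulrDr.
Qed.

Lemma dotZr a (t : R) x : dot a (t *: x) = t * dot a x.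
Proof.
by rewrite /dot mulr_sumr; apply: eq_bigr => i _; rewrite mxE mulrCA.
Qed.

Lemma dot0l x : dot 0 x = 0.
Proof. by rewrite /dot big1// => i _; rewrite mxE mul0r. Qed.

Lemma dotBr a x y : dot a (x - y) = dot a x - dot a y.
Proof. by rewrite dotDr -scaleN1r dotZr mulN1r. Qed.

End Dot.

Section IntegerHelly.
Context {R : realType} {q : nat}.
Lemma seq_argmin (T : eqType) (g : T -> R) (s : seq T) :
  s != [::] ->
  exists2 z, z \in s & forall x, x \in s -> g z <= g x.
Proof.
elim: s => [//|y s IH] _.
have [->|/IH[z zs zmin]] := eqVneq s [::].
  by exists y; rewrite ?mem_seq1// => x; rewrite mem_seq1 => /eqP->.
have [yz|zy] := lerP (g y) (g z).
  exists y; first by rewrite mem_head.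
  move=> x; rewrite in_cons => /predU1P[->//|/zmin]; exact: le_trans.
exists z; first by rewrite in_cons zs orbT.
by move=> x; rewrite in_cons => /predU1P[->|/zmin//]; exact: ltW.
Qed.

Implicit Types (a x y z : 'rV[R]_q).

(** The class of a lattice point modulo 2; the floor only converts real coordinates to integers. *)
Definition parity x : {ffun 'I_q -> bool} :=
  [ffun i => odd `|Num.floor (x 0%R i)|%N].

Lemma midpoint_integer x y : integer_points x -> integer_points y ->
  parity x = parity y -> integer_points (2^-1 *: (x + y)).
Proof.
move=> /mxOverP xi /mxOverP yi xy; apply/mxOverP => i j.
rewrite ord1 !mxE.
have := congr1 (fun p : {ffun _ -> _} => p j) xy; rewrite !ffunE.
have /intrP[m ->] := xi 0 j; have /intrP[n ->] := yi 0 j.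
rewrite !intrKfloor => mn.
have -> : 2^-1 * (m%:~R + n%:~R) = ((m + n) %/ 2)%Z%:~R :> R.
  rewrite -intrD; have {1}-> : m + n = ((m + n) %/ 2)%Z * 2 by lia.
  by rewrite intrM mulrCA mulVf ?mulr1// pnatr_eq0.
exact: intr_int.
Qed.

(* Two lattice points of equal parity have an integral midpoint: if more than
   [2 ^ q] half-spaces are needed, push each of them as far as possible until it
   is stopped by a point covered by no other half-space; two of these points
   have the same parity, and no half-space covers their midpoint. *)
Lemma integer_helly (f : 'rV[R]_q) (A : set 'rV[R]_q) (F : seq 'rV[R]_q) :
  (forall x, x \in F -> integer_points x) ->
  (forall x y, x \in F -> y \in F -> integer_points (2^-1 *: (x + y)) ->
     2^-1 *: (x + y) \in F) ->
  (forall x, x \in F -> exists2 a, A a & 1 <= dot a (x - f)) ->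
  exists c : seq 'rV[R]_q, [/\ (size c <= 2 ^ q)%N,
    forall a, a \in c -> A a
    & forall x, x \in F -> exists2 a, a \in c & 1 <= dot a (x - f)].
Proof.
move=> Fint Fmid FA.
(* A pair [p] stands for the half-space [p.2 <= dot p.1 (x - f)]. Levels above 1 are allowed in
   [good], which leaves room for pushing half-spaces away from [f]. *)
pose g (p : 'rV[R]_q * R) x := dot p.1 (x - f).
pose cov c x := has (fun p => p.2 <= g p x) c.
pose good (c : seq ('rV[R]_q * R)) :=
  (forall p, p \in c -> A p.1 /\ 1 <= p.2) /\ (forall x, x \in F -> cov c x).
pose cnt (p : 'rV[R]_q * R) := count (fun x => p.2 <= g p x) F.
(* The measure drops when a half-space is discarded, owing to the summand 1, and also when one is
   pushed so far that it covers fewer points. *)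
pose meas (c : seq ('rV[R]_q * R)) := \sum_(p <- c) (1 + cnt p)%N.
suff [c [csize [cA ccov]]] : exists c, (size c <= 2 ^ q)%N /\ good c.
  exists (map fst c); split; first by rewrite size_map.
    by move=> _ /mapP[p pc ->]; exact: (cA _ pc).1.
  move=> x /ccov/hasP[p pc px]; exists p.1; first exact: map_f.
  exact: le_trans (cA _ pc).2 px.
have [c0 c0good] : exists c, good c.
  have /choice[h hP] : forall x, exists a, x \in F -> A a /\ 1 <= dot a (x - f).
    move=> x; have [/FA[a Aa ax]|] := boolP (x \in F); first by exists a.
    by exists 0.
  exists [seq (h x, 1) | x <- F]; split=> [_ /mapP[x /hP[Ahx _] ->]//|x xF].
  by apply/hasP; exists (h x, 1); [exact: map_f|exact: (hP _ xF).2].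
have [n nc0] : exists n, meas c0 = n by exists (meas c0).
elim/ltn_ind: n c0 c0good nc0 => n IH c [cA ccov] cn.
apply: contrapT => nosmall.
have cmin c' : (meas c' < meas c)%N -> good c' -> False.
  by rewrite cn => lt c'good; apply: nosmall; exact: IH c'good erefl.
(* In a cover of least measure no half-space can be discarded. *)
have crem p : p \in c -> exists2 x, x \in F & ~~ cov (rem p c) x.
  move=> pc; apply: contrapT => hx; apply: (cmin (rem p c)).
    rewrite /meas [X in (_ < X)%N](perm_big _ (perm_to_rem pc)) big_cons.
    by rewrite -[X in (X < _)%N]add0n ltn_add2r.
  split=> [p' /mem_rem/cA//|x xF].
  by apply: contrapT => /negP xn; apply: hx; exists x.
(* [z] minimizes [g p] over the points covered by [p] alone, so raising the level of [p] to [g p z]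
   preserves the cover. A point of [p] at a lower level would be lost, and the measure would
   drop. *)
have stop p : p \in c -> exists z, [/\ z \in F, ~~ cov (rem p c) z,
    p.2 <= g p z & forall x, x \in F -> p.2 <= g p x -> g p z <= g p x].
  move=> pc; pose Z := [seq x <- F | ~~ cov (rem p c) x].
  have covp x : x \in Z -> p.2 <= g p x.
    rewrite mem_filter => /andP[xc /ccov].
    move: xc; rewrite /cov (perm_has _ (perm_to_rem pc))/=.
    by move=> /negPf ->; rewrite orbF.
  have [|z zZ zmin] := @seq_argmin _ (g p) Z.
    have [x xF xc] := crem p pc.
    by apply/eqP => Z0; have := mem_filter (fun x => ~~ cov (rem p c) x) x F;
      rewrite -/Z Z0 xF xc.
  have := zZ; rewrite mem_filter => /andP[zc zF].
  exists z; split=> //; first exact: covp.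
  move=> x xF px; rewrite leNgt; apply/negP => xz.
  apply: (cmin ((p.1, g p z) :: rem p c)).
    rewrite /meas [X in (_ < X)%N](perm_big _ (perm_to_rem pc)) !big_cons/=.
    rewrite ltn_add2r ltn_add2l /cnt/=.
    rewrite !(permP (perm_to_rem xF)) /= px [g p z <= _]leNgt xz/= add0n.
    rewrite add1n ltnS; apply: sub_count => y /=.
    exact: le_trans (covp _ zZ).
  split=> [p'|y yF]; last first.
    have [yc|yc] := boolP (cov (rem p c) y).
      apply/hasP; have /hasP[p' p'c p'y] := yc.
      by exists p' => //; rewrite in_cons p'c orbT.
    by rewrite /cov/= zmin// mem_filter yc yF.
  rewrite in_cons => /predU1P[->/=|/mem_rem/cA//].
  by split; [exact: (cA _ pc).1|apply: le_trans (cA _ pc).2 (covp _ zZ)].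
have /choice[z zP] : forall p, exists z, p \in c -> [/\ z \in F,
    ~~ cov (rem p c) z, p.2 <= g p z
    & forall x, x \in F -> p.2 <= g p x -> g p z <= g p x].
  move=> p; have [/stop[z ?]|] := boolP (p \in c); first by exists z.
  by exists 0.
have lt p p' : p \in c -> p' \in c -> p' != p -> g p' (z p) < p'.2.
  move=> pc p'c p'p; have [_ /hasPn h _ _] := zP _ pc.
  rewrite ltNge; apply: h.
  have := p'c; rewrite (perm_mem (perm_to_rem pc)) in_cons.
  by rewrite (negPf p'p).
(* A second copy of [p] would cover [z p]. *)
have uc : uniq c.
  apply: count_mem_uniq => p; have [pc|/count_memPn//] := boolP (p \in c).
  rewrite (permP (perm_to_rem pc)) /= eqxx.
  have -> : count_mem p (rem p c) = 0%N; last by [].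
  apply/count_memPn/negP => pr; have [_ /hasPn/(_ _ pr) h h' _] := zP _ pc.
  by rewrite h' in h.
apply: nosmall; exists c; split=> //.
rewrite -(size_map (fun p => parity (z p))).
have -> : (2 ^ q)%N = #|{ffun 'I_q -> bool}|.
  by rewrite card_ffun card_bool card_ord.
have /card_uniqP <- : uniq [seq parity (z p) | p <- c]; last exact: max_card.
rewrite map_inj_in_uniq// => p p' pc p'c par.
apply: contrapT => /eqP pp'.
have [zF _ pz pmin] := zP _ pc; have [zF' _ pz' pmin'] := zP _ p'c.
have mid : 2^-1 *: (z p + z p') \in F.
  by apply: Fmid => //; apply: midpoint_integer => //; exact: Fint.
have gmid r : g r (2^-1 *: (z p + z p')) = (g r (z p) + g r (z p')) / 2.
  by rewrite /g !dotBr dotZr dotDr; field.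
have zp' := lt _ _ p'c pc pp'.
have zp : g p' (z p) < p'.2 by apply: lt => //; rewrite eq_sym.
(* Some [r] covers the midpoint. If [r] is [p], minimality of [z p] forces
   [g p (z p) <= g p (z p')], although [z p'] lies outside [p]; likewise for [p']. Any other [r]
   contains neither point, hence not their midpoint. *)
have /hasP[r rc] := ccov _ mid.
have [->|rp] := eqVneq r p.
  by move=> /(pmin _ mid); rewrite gmid; lra.
have [->|rp'] := eqVneq r p'.
  by move=> /(pmin' _ mid); rewrite gmid; lra.
by rewrite gmid; have := lt _ _ pc rc rp; have := lt _ _ p'c rc rp'; lra.
Qed.

End IntegerHelly.

(** * Geometry of the translate *)

Section ConvexSets.
Context {R : realType} {M : lmodType R}.

Lemma convex_setP (A : set M) : convex_set A <->
  forall x y (t : R), A x -> A y -> 0 <= t -> t <= 1 ->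
    A (t *: x + (1 - t) *: y).
Proof.
split=> [cA x y t Ax Ay t0 t1|cA x y t].
  have /set_mem := cA _ _ (Itv01 t0 t1) (mem_set Ax) (mem_set Ay); exact.
by move=> /set_mem Ax /set_mem Ay; apply/mem_set; exact: cA.
Qed.

End ConvexSets.

Section RowVectors.
Context {R : realType} {q : nat}.
Implicit Types (a x : 'rV[R]_q).

Lemma coord_le_norm x i : `|x 0 i| <= `|x|.
Proof.
have [->|x0] := eqVneq (x 0 i) 0; first by rewrite normr0.
rewrite [leRHS]/Num.Def.normr/= mx_normrE; apply/bigmax_geP; right.
by exists (0, i).
Qed.

End RowVectors.

Section RelativeInterior.
Context {R : realType} {q : nat} (f : 'rV[R]_q) (W : {vspace 'rV[R]_q}).
Implicit Types (x y : 'rV[R]_q) (B : set 'rV[R]_q) (w : subvs_of W).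
Local Notation T := (translate f W).
Local Notation L := (T `&` integer_points).

Lemma translateP x : T x <-> x - f \in W.
Proof.
split=> [[w wW <-]|xW]; first by rewrite addrC addKr.
by exists (x - f) => //; rewrite addrC subrK.
Qed.

Lemma translateE x : T x -> f + vsval (vsproj W (x - f)) = x.
Proof. by move=> /translateP xW; rewrite vsprojK// addrC subrK. Qed.

Lemma translate_vsval x w : T x -> T (x + vsval w).
Proof.
by move=> /translateP xW; apply/translateP; rewrite addrAC rpredD// subvsP.
Qed.

Lemma translate_base w : T (f + vsval w).
Proof. by apply: translate_vsval; apply/translateP; rewrite subrr rpred0. Qed.

Lemma translate_comb x y (s t : R) : s + t = 1 -> T x -> T y ->
  T (s *: x + t *: y).
Proof.
move=> st /translateP xW /translateP yW; apply/translateP.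
have -> : s *: x + t *: y - f = s *: (x - f) + t *: (y - f).
  by rewrite !scalerBr addrACA -opprD -scalerDl st scale1r.
by rewrite rpredD// rpredZ.
Qed.

Lemma translate_ray x (e : R) : T x -> T (x + e *: (x - f)).
Proof. by move=> Tx; have := translate_vsval (e *: vsproj W (x - f)) Tx;
  rewrite linearZ/= vsprojK//; apply/translateP. Qed.

Lemma rel_interiorP B x : B `<=` T ->
  (rel_interior f W B x <->
   T x /\ exists2 d : R, 0 < d & forall w, `|vsval w| < d -> B (x + vsval w)).
Proof.
move=> BT; rewrite /rel_interior /interior/=; split=> [Bx|[Tx [d d0 dB]]].
  have Tx : T x := BT _ (nbhs_subspace_singleton Bx).
  split=> //; move: Bx; rewrite {1}/nbhs/= -nbhs_subspace_in//.
  move=> /nbhs_ballP[d d0 dB]; exists d => // w wd; apply: dB.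
    by rewrite -ball_normE/= opprD addrA subrr sub0r normrN.
  exact: translate_vsval.
rewrite {1}/nbhs/= -nbhs_subspace_in//; apply/nbhs_ballP; exists d => // y.
rewrite -ball_normE/= => xy Ty.
have yxW : y - x \in W.
  have -> : y - x = (y - f) - (x - f) by rewrite opprB addrA subrK.
  by rewrite rpredB//; apply/translateP.
have := dB (vsproj W (y - x)); rewrite vsprojK// [x + _]addrC subrK.
by rewrite -normrN opprB; exact.
Qed.

Lemma rel_interior_ray B x : B `<=` T -> convex_set B ->
  rel_interior f W B f ->
  (rel_interior f W B x <-> T x /\ exists2 e : R, 0 < e & B (x + e *: (x - f))).
Proof.
move=> BT /convex_setP Bc /(rel_interiorP _ BT)[_ [d d0 dB]].
split=> [/(rel_interiorP _ BT)[Tx [d' d'0 d'B]]|[Tx [e e0 Be]]].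
  split=> //; pose e := d' / (1 + `|x - f|).
  have n0 : 0 < 1 + `|x - f| by rewrite ltr_pwDl.
  have e0 : 0 < e by rewrite divr_gt0.
  exists e => //.
  have := d'B (e *: vsproj W (x - f)); rewrite linearZ/= vsprojK; last first.
    exact/translateP.
  apply; rewrite normrZ gtr0_norm// /e -mulrA gtr_pMr// mulrC ltr_pdivrMr//.
  by rewrite mul1r ltrDr.
(* The homothety with centre [x + e *: (x - f)] and ratio [e / (1 + e)] sends [f] to [x], and the
   ball of radius [d] about [f] to the required ball about [x]. *)
apply/rel_interiorP => //; split=> //; exists (e / (1 + e) * d).
  by rewrite !mulr_gt0// invr_gt0 addr_gt0.
have e1 : 0 < 1 + e by rewrite addr_gt0.
move=> w; rewrite -ltr_pdivrMl ?divr_gt0// invf_div => wd.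
have := dB (((1 + e) / e) *: w).
rewrite linearZ/= normrZ gtr0_norm ?divr_gt0// => /(_ wd) Bw.
have := Bc _ _ (1 + e)^-1 Be Bw; rewrite invr_ge0 ltW// => /(_ isT).
rewrite invf_le1// lerDl ltW// => /(_ isT).
congr B; apply/rowP => i; rewrite !mxE; field.
by rewrite !gt_eqF.
Qed.

(** Replaces the topology by rays from [f]; lattice-freeness is checked in this form from here
    on. *)
Lemma lattice_freeP B : B `<=` T -> convex_set B -> rel_interior f W B f ->
  (lattice_free_convex f W B <->
   forall x (e : R), L x -> 0 < e -> ~ B (x + e *: (x - f))).
Proof.
move=> BT Bc Bf; split=> [[_ _ Bl] x e [Tx xi] e0 Bx|Bl].
  suff : (rel_interior f W B `&` integer_points) x by rewrite Bl.
  by split=> //; apply/rel_interior_ray => //; split=> //; exists e.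
split=> //; rewrite -subset0 => x [/(rel_interior_ray _ BT Bc Bf)[Tx [e e0]]].
by move=> /[swap] xi; exact: Bl.
Qed.

(* Every relative neighbourhood of [f] bounds the functionals that are at most
   [1] on it. *)
Lemma supporting_functional B : B `<=` T -> convex_set B ->
  rel_interior f W B f -> exists C : R, 0 <= C /\
  forall x, T x -> (forall e : R, 0 < e -> ~ B (x + e *: (x - f))) ->
  exists a : 'rV[R]_q, [/\ forall y, B y -> dot a (y - f) <= 1,
    forall i, `|a 0 i| <= C & 1 <= dot a (x - f)].
Proof.
move=> BT /convex_setP Bc /(rel_interiorP _ BT)[_ [d d0 dB]].
pose e_ i : subvs_of W := vsproj W (delta_mx 0 i).
pose b w := (1 + `|vsval w|) / d.
have n0 w : 0 < 1 + `|vsval w| by rewrite ltr_pwDl.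
have b0 w : 0 < b w by rewrite divr_gt0.
have Babs w : B (f + vsval ((b w)^-1 *: w)).
  apply: dB; rewrite linearZ/= normrZ gtr0_norm ?invr_gt0// /b invf_div.
  by rewrite mulrAC -mulrA gtr_pMr// mulrC ltr_pdivrMl// mulr1 ltrDr.
exists (\sum_i b (e_ i)); split; first by apply: sumr_ge0 => i _; exact: ltW.
move=> x Tx Bx.
have xfW : x - f \in W by exact/translateP.
have [| | |phi [phi1 phix]] :=
    @gauge_separation R (subvs_of W) [set w | B (f + vsval w)]
      (vsproj W (x - f)).
- move=> v w t /= Bv Bw t0 t1; have := Bc _ _ _ Bv Bw t0 t1.
  by congr B; apply/rowP => i; rewrite linearD/= scalerDr !mxE; ring.
- by move=> w; exists (b w)^-1; split; [rewrite invr_gt0|exact: Babs].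
- move=> c c1 /=; rewrite vsprojK//.
  have := Bx (c - 1); rewrite subr_gt0 => /(_ c1) + BB; apply.
  by move: BB; congr B; apply/rowP => i; rewrite !mxE; ring.
have phib w : phi w <= b w.
  by have := phi1 _ (Babs w); rewrite linearZ/= ler_pdivrMl// mulr1.
(* [phi] lives on [W] only; [a] represents its composition with the projection onto [W], so the
   coordinates of [a] are values of [phi] at the projected unit vectors. *)
pose a := \row_i phi (e_ i).
have aE v : dot a v = phi (vsproj W v).
  rewrite [in RHS](row_sum_delta v) /dot linear_sum linear_sum.
  by apply: eq_bigr => i _; rewrite mxE !linearZ/= mulrC.
exists a; split.
- move=> y By; rewrite aE; apply: phi1 => /=.
  by rewrite translateE//; exact: BT.
- move=> i; rewrite mxE; apply: (@le_trans _ _ (b (e_ i))); last first.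
    by rewrite (bigD1 i)//= lerDl sumr_ge0// => j _; exact: ltW.
  rewrite ler_norml phib andbT lerNl -linearN/=.
  by apply: le_trans (phib _) _; rewrite /b linearN/= normrN.
- by rewrite aE.
Qed.

End RelativeInterior.

(** * Maximal lattice-free sets are polyhedra *)

Section LatticeFree.
Context {R : realType} {q : nat} (f : 'rV[R]_q) (W : {vspace 'rV[R]_q}).
Implicit Types (x y : 'rV[R]_q) (B : set 'rV[R]_q) (w : subvs_of W).
Local Notation T := (translate f W).
Local Notation L := (T `&` integer_points).

Lemma lattice_points_box (k : nat) : exists F : seq 'rV[R]_q,
  forall x, x \in F <-> L x /\ forall i, `|x 0 i| <= k%:R.
Proof.
(* [m i] runs through [0..2k], hence [m i - k] through [-k..k]. *)
pose pt (m : {ffun 'I_q -> 'I_(k.*2.+1)}) : 'rV[R]_q :=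
  \row_i ((m i : nat)%:R - k%:R).
exists [seq x <- [seq pt m | m : {ffun 'I_q -> 'I_(k.*2.+1)}] | `[< T x >]].
move=> x; rewrite mem_filter; split=> [/andP[/asboolP Tx /mapP[m _ xE]]|].
  split=> [|i].
    split=> //; apply/mxOverP => i j; rewrite xE mxE rpredB ?natr_int//.
  have : ((m i)%:R <= (k + k)%:R :> R).
    by rewrite ler_nat addnn -ltnS ltn_ord.
  by rewrite xE mxE ler_norml natrD; have := ler0n R (m i); lra.
move=> [[Tx /mxOverP xi] xk]; apply/andP; split; first exact/asboolP.
apply/mapP; exists [ffun i => inord `|(Num.floor (x 0 i) + k%:Z)%R|%N];
  first exact: mem_enum.
apply/rowP => i; rewrite mxE ffunE.
have /intrP[z xz] := xi 0 i; have := xk i; rewrite xz intrKfloor.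
rewrite -intr_norm -[k%:R]/(k%:~R) ler_int => zk.
rewrite inordK; last by lia.
set n := `|_|%N; transitivity ((Posz n)%:~R - (Posz k)%:~R : R) => //.
by rewrite -intrB; congr (_%:~R); lia.
Qed.

(** Compactness: a family of [N] bounded vectors is encoded as one point of a box in dimension
    [N * q], and a cluster point of these families as [k] grows is taken. Each lattice point is
    covered from some [k] on, and being covered is a closed condition. *)
Lemma limit_of_coverings (C : R) B N : 0 <= C ->
  (forall k : nat, exists c : seq 'rV[R]_q, [/\ (size c <= N)%N,
     forall a, a \in c ->
       (forall y, B y -> dot a (y - f) <= 1) /\ forall i, `|a 0 i| <= C
     & forall x, L x -> (forall i, `|x 0 i| <= k%:R) ->
       exists2 a, a \in c & 1 <= dot a (x - f)]) ->
  exists a : 'I_N -> 'rV[R]_q,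
    (forall y, B y -> forall i, dot (a i) (y - f) <= 1) /\
    forall x, L x -> exists i, 1 <= dot (a i) (x - f).
Proof.
move=> C0 cov.
pose vec (v : 'rV[R]_(N * q)) i : 'rV[R]_q := row i (vec_mx v).
have vecE v i j : vec v i 0 j = v 0 (mxvec_index i j) by rewrite !mxE.
have dc i y : continuous (fun v => dot (vec v i) y).
  apply: (continuous_big (op := +%R)) => [|j _]; first exact: add_continuous.
  rewrite (_ : (fun v => vec v i 0 j * y 0 j) =
      fun v : 'rV[R]_(N * q) => v 0 (mxvec_index i j) * y 0 j).
    by move=> v; exact: (@cvgMr_tmp R _ (nbhs v) _
    (fun v : 'rV[R]_(N * q) => v 0 (mxvec_index i j)) _ _
    (@coord_continuous R 1 (N * q) 0 (mxvec_index i j) v)).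
  by apply/funext => v; rewrite vecE.
have /choice[v vP] (k : nat) : exists v,
    [/\ forall y i, B y -> dot (vec v i) (y - f) <= 1,
    forall j, `|v 0 j| <= C & forall x, L x -> (forall i, `|x 0 i| <= k%:R) ->
      exists i, 1 <= dot (vec v i) (x - f)].
  have [c [cN cA cL]] := cov k.
  (* Shorter families are padded with the zero vector, which satisfies both bounds. *)
  pose M := \matrix_(i < N, j < q) (nth 0 c i) 0 j.
  have ME i : vec (mxvec M) i = nth 0 c i.
    by apply/rowP => j; rewrite /vec mxvecK !mxE.
  have nthA i : (forall y, B y -> dot (nth 0 c i) (y - f) <= 1) /\
      forall j, `|(nth 0 c i) 0 j| <= C.
    have [ic|ic] := ltnP i (size c); first by apply: cA; exact: mem_nth.
    rewrite nth_default//; split=> [y _|j]; first by rewrite dot0l.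
    by rewrite mxE normr0.
  exists (mxvec M); split.
  - by move=> y i By; rewrite ME; exact: (nthA i).1.
  - move=> j; case/mxvec_indexP: j => i j.
    by rewrite mxvecE mxE; exact: (nthA i).2.
  - move=> x Lx xk; have [a ac ax] := cL x Lx xk.
    have ic := ac; rewrite -index_mem in ic.
    exists (Ordinal (leq_trans ic cN)).
    by rewrite ME/= nth_index.
have Kc : compact
    [set v : 'rV[R]_(N * q) | forall j, `[- C, C]%classic (v 0 j)].
  apply: (@rV_compact _ _ (fun=> `[- C, C]%classic)) => j.
  exact: segment_compact.
have [|u [_ uv]] := Kc (v @ \oo) _.
  exists 0%N => // k _ j /=; rewrite in_itv/= -ler_norml.
  by have [_ h _] := vP k; exact: h.
exists (vec u); split=> [y By i|x Lx].
  rewrite leNgt; apply/negP => ui.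
  have /= lt : \forall v' \near u, 1 < dot (vec v' i) (y - f).
    exact: (cvgr_gt _ (dc i (y - f) u)).
  have vB : (v @ \oo) [set v' | dot (vec v' i) (y - f) <= 1].
    by exists 0%N => // k _ /=; have [vk _ _] := vP k; exact: vk.
  by have [v' [/= le1]] := uv _ _ vB lt; rewrite ltNge le1.
(* If [x] satisfied all inequalities strictly for [u], it would do so for all families near [u],
   among them coverings of a box containing [x]. *)
apply: contrapT => ux.
have /= : \forall v' \near u, forall i, dot (vec v' i) (x - f) < 1.
  apply: (@filter_forall _ _ (fun i v' => dot (vec v' i) (x - f) < 1)
    (nbhs u)) => i.
  have : dot (vec u i) (x - f) < 1.
    by rewrite ltNge; apply/negP => ?; apply: ux; exists i.
  by move=> lt; apply: (cvgr_lt _ (dc i (x - f) u)).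
have [k0 xk0] : exists k0 : nat, forall i, `|x 0 i| <= k0%:R.
  exists (Num.truncn `|x|).+1 => i; apply: le_trans (coord_le_norm x i) _.
  exact/ltW/truncnS_gt.
have vk0 : (v @ \oo) [set v' | exists i, 1 <= dot (vec v' i) (x - f)].
  exists k0 => // k /= k0k; have [_ _] := vP k; apply => // i.
  by apply: le_trans (xk0 i) _; rewrite ler_nat.
move=> /(uv _ _ vk0)[v' [[i vi] /(_ i)]].
by rewrite ltNge vi.
Qed.

(** The Helly bound [2 ^ q] is the same for all boxes, as the limit argument requires. *)
Lemma lattice_free_polyhedron B : lattice_free_convex f W B ->
  rel_interior f W B f -> exists N (a : 'I_N -> 'rV[R]_q),
    (forall y, B y -> forall i, dot (a i) (y - f) <= 1) /\
    forall x, L x -> exists i, 1 <= dot (a i) (x - f).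
Proof.
move=> Bl Bf; have [BT Bc _] := Bl.
have [C [C0 supp]] := supporting_functional BT Bc Bf.
exists (2 ^ q)%N; apply: (limit_of_coverings C0) => k.
have [F FP] := lattice_points_box k.
pose A := [set a | (forall y, B y -> dot a (y - f) <= 1) /\
  forall i, `|a 0 i| <= C].
have [x /FP[[]]//|x y xF yF xyi|x|c [cN cA cF]] := @integer_helly _ _ f A F.
- move: xF yF => /FP[[Tx xi] xk] /FP[[Ty yi] yk]; apply/FP; split.
    split=> //; rewrite scalerDr; apply: translate_comb => //; lra.
  move=> i; rewrite !mxE normrM ger0_norm ?invr_ge0//.
  rewrite ler_pdivrMl//; apply: le_trans (ler_normD _ _) _.
  by have := xk i; have := yk i; lra.
- move=> /FP[Lx _]; have [|a [aB aC ax]] := supp x Lx.1; last by exists a.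
  by move=> e e0; exact: (lattice_freeP BT Bc Bf).1.
- by exists c; split=> // x Lx xk; apply: cF; apply/FP.
Qed.

(** Moving from [x] to [x + e *: (x - f)] multiplies each form by [1 + e], so a form that is at
    least 1 at [x] exceeds 1 beyond [x]. *)
Lemma halfspaces_lattice_free B N (a : 'I_N -> 'rV[R]_q) :
  lattice_free_convex f W B -> rel_interior f W B f ->
  (forall y, B y -> forall i, dot (a i) (y - f) <= 1) ->
  (forall x, L x -> exists i, 1 <= dot (a i) (x - f)) ->
  lattice_free_convex f W (halfspaces f W a predT).
Proof.
move=> [BT _ _] Bf aB aL.
have PT : halfspaces f W a predT `<=` T by move=> x [].
have Pc : convex_set (halfspaces f W a predT).
  apply/convex_setP => x y t [Tx xa] [Ty ya] t0 t1.
  split=> [|i _]; first by apply: translate_comb => //; lra.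
  have -> : t *: x + (1 - t) *: y - f = t *: (x - f) + (1 - t) *: (y - f).
    by apply/rowP => j; rewrite !mxE; ring.
  rewrite dotDr !dotZr; have := xa i isT; have := ya i isT; nra.
have Pf : rel_interior f W (halfspaces f W a predT) f.
  have /(rel_interiorP _ BT)[Tf [d d0 dB]] := Bf.
  apply/rel_interiorP => //; split=> //; exists d => // w /dB Bw.
  by split=> [|i _]; [exact: BT|exact: aB].
apply/lattice_freeP => // x e Lx e0 [_ xa].
have [i ai] := aL x Lx; have := xa i isT.
by rewrite addrAC dotDr dotZr; nra.
Qed.

Lemma BW_irredundant_repr B : L !=set0 -> BW f W B ->
  exists t (a : 'I_t.+1 -> 'rV[R]_q), irredundant_repr f W B a.
Proof.
move=> [x0 Lx0] [[Bl Bmax] Bf].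
have [N0 [a0 [aB aL]]] := lattice_free_polyhedron Bl Bf.
(* A description with the fewest inequalities is irredundant. *)
pose repr N := `[< exists a : 'I_N -> 'rV[R]_q, B = halfspaces f W a predT >].
have : exists N, repr N.
  exists N0; apply/asboolP; exists a0; apply/esym/Bmax.
    exact: (halfspaces_lattice_free Bl Bf).
  by move=> x Bx; split=> [|i _]; [case: Bl => + _ _; exact|exact: aB].
move=> /ex_minnP[[|t] /asboolP[a Ba] tmin].
  (* With no inequalities, [B] would be the whole translate and contain points beyond [x0]. *)
  have [BT Bc _] := Bl.
  have /(lattice_freeP BT Bc Bf)/(_ x0 1 Lx0 ltr01)[] := Bl.
  by rewrite Ba; split=> [|[]//]; exact: translate_ray Lx0.1.
exists t, a; split=> // j aj.
suff : repr t by move=> /tmin; rewrite ltnn.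
apply/asboolP; exists (a \o lift j); rewrite -aj.
apply/seteqP; split=> x [Tx xa]; split=> // i ij.
  by apply: xa; rewrite /= eq_sym neq_lift.
have [i' ->|ji] := unliftP j i; first exact: xa.
by move: ij; rewrite ji /= eqxx.
Qed.

(** A description exists, so the choice in [psi] never falls back to its default value. *)
Lemma psi_max_form B : L !=set0 -> BW f W B ->
  exists t (a : 'I_t.+1 -> 'rV[R]_q),
    irredundant_repr f W B a /\ psi f W B = max_form a.
Proof.
move=> L0 BB; have [t [a ra]] := BW_irredundant_repr L0 BB.
have ex : exists p : subvs_of W -> R, exists t (a : 'I_t.+1 -> 'rV[R]_q),
    irredundant_repr f W B a /\ p = max_form a by exists (max_form a), t, a.
exact: (xgetPex (fun=> 0) ex).
Qed.

Lemma le_max_form t (a : 'I_t.+1 -> 'rV[R]_q) i w :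
  dot (a i) (vsval w) <= max_form a w.
Proof. exact: (le_bigmax _ (fun i => dot (a i) (vsval w))). Qed.

Lemma max_form_le t (a : 'I_t.+1 -> 'rV[R]_q) w c :
  (forall i, dot (a i) (vsval w) <= c) -> max_form a w <= c.
Proof. by move=> ac; apply: bigmax_le. Qed.

End LatticeFree.

(** * Finitely supported functions *)

Section EuclideanNorm.
Context {R : realType} {q : nat}.
Implicit Types (a x : 'rV[R]_q).

Lemma coord_le_enorm x i : `|x 0 i| <= enorm x.
Proof.
rewrite -sqrtr_sqr; apply: ler_wsqrtr.
rewrite /dot (bigD1 i)//= -expr2 lerDl; apply: sumr_ge0 => j _.
by rewrite -expr2 sqr_ge0.
Qed.

Lemma dot_le_enorm a x : `|dot a x| <= (\sum_i `|a 0 i|) * enorm x.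
Proof.
apply: le_trans (ler_norm_sum _ _ _) _; rewrite mulr_suml.
apply: ler_sum => i _.
by rewrite normrM ler_wpM2l// coord_le_enorm.
Qed.

Lemma enorm_le_norm x : enorm x <= q%:R * `|x|.
Proof.
have q0 : 0 <= q%:R * `|x| by rewrite mulr_ge0.
rewrite -(ler_pXn2r (n := 2))// ?nnegrE ?enorm_ge0//.
rewrite sqr_sqrtr; last by apply: sumr_ge0 => i _; rewrite -expr2 sqr_ge0.
apply: (@le_trans _ _ (\sum_(i < q) `|x| ^+ 2)).
  apply: ler_sum => i _; rewrite -expr2 -real_normK ?num_real//.
  by rewrite ler_pXn2r ?nnegrE// coord_le_norm.
rewrite sumr_const card_ord -[leLHS]mulr_natl exprMn ler_wpM2r ?sqr_ge0//.
by rewrite -natrX ler_nat; case: (q) => // n; rewrite expnS leq_pmulr.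
Qed.

Lemma enorm0 : enorm (0 : 'rV[R]_q) = 0.
Proof. by rewrite /enorm dot0l sqrtr0. Qed.

Lemma enormN x : enorm (- x) = enorm x.
Proof.
rewrite /enorm; congr (Num.sqrt _); apply: eq_bigr => i _.
by rewrite !mxE mulrNN.
Qed.

End EuclideanNorm.

(** * Affine sets as solution sets of linear equations *)

Section AffineSets.
Context {R : realType} {q : nat}.

Lemma affine_hull_affine (A : set 'rV[R]_q) : affine_set (affine_hull A).
Proof. by move=> x y t Ax Ay B BA; apply: BA.1; [apply: Ax|apply: Ay]. Qed.

Lemma affine_direction (A : set 'rV[R]_q) x0 : affine_set A -> A x0 ->
  (forall t v, A (x0 + v) -> A (x0 + t *: v)) /\
  (forall u v, A (x0 + u) -> A (x0 + v) -> A (x0 + (u + v))).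
Proof.
move=> Aa A0; have AZ t v : A (x0 + v) -> A (x0 + t *: v).
  move=> Av; have := Aa _ _ t Av A0.
  by congr A; apply/rowP => i; rewrite !mxE; ring.
split=> // u v /(AZ 2) Au /(AZ 2) Av; have := Aa _ _ 2^-1 Au Av.
by congr A; apply/rowP => i; rewrite !mxE; field.
Qed.

(** Among the row spaces contained in the direction of [A], one of maximal rank is the whole
    direction; its cokernel gives the equations. Equations, unlike hulls, pass to the closure. *)
Lemma affine_set_equations (A : set 'rV[R]_q) x0 : affine_set A -> A x0 ->
  exists K : 'M[R]_q, forall x, A x <-> (x - x0) *m K = 0.
Proof.
move=> Aa A0; have [AZ AD] := affine_direction Aa A0.
pose inA (M : 'M[R]_q) := forall v : 'rV[R]_q, (v <= M)%MS -> A (x0 + v).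
pose has_rank n := `[< exists2 M, \rank M = n & inA M >].
have ex : exists n, has_rank n.
  exists 0%N; apply/asboolP; exists 0; first exact: mxrank0.
  by move=> v; rewrite submx0 => /eqP->; rewrite addr0.
have bound n : has_rank n -> (n <= q)%N.
  by move=> /asboolP[M <- _]; exact: rank_leq_row.
case: (ex_maxnP ex bound) => n /asboolP[M Mn AM] nmax.
exists (cokermx M) => x; rewrite (rwP eqP) -submxE.
split=> [Ax|/AM]; last first.
  by rewrite addrC subrK.
have : inA (M + (x - x0))%MS.
  move=> v /sub_addsmxP[[u1 u2] ->] /=; apply: AD.
    by apply: AM; exact: submxMl.
  rewrite [u2]mx11_scalar mul_scalar_mx; apply: AZ.
  by rewrite addrC subrK.
move=> inAx; have : (\rank (M + (x - x0)%R)%MS <= n)%N.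
  by apply: nmax; apply/asboolP; exists (M + (x - x0))%MS.
rewrite -Mn => le; have := mxrank_leqif_sup (addsmxSl M (x - x0)).
move=> [_ e]; apply: submx_trans (addsmxSr M (x - x0)) _.
by rewrite -e eqn_leq le mxrankS// addsmxSl.
Qed.

End AffineSets.

Section FinSuppSums.
Context {R : realType} {q : nat} {W : {vspace 'rV[R]_q}}.
Implicit Types (s t : finsupp_fun W) (r : subvs_of W).

(** A single linear map covering the vector [\sum_r s_r r] (for [g = id]) and the left-hand sides of
    the inequalities (for [g = psi f W B]). *)
Definition fssum {V : lmodType R} (g : subvs_of W -> V) s : V :=
  \sum_(r \in [set: subvs_of W]) s r *: g r.

Definition fssupp s : {fset subvs_of W} := fset_set [set r | s r != 0].

Lemma fssuppP s r : s r != 0 -> r \in fssupp s.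
Proof.
move=> sr; rewrite in_fset_set; first exact/mem_set.
exact/fin_suppP/coef_fin_supp.
Qed.

Lemma fsbig_fset_widen {V : nmodType} (D : {fset subvs_of W})
  (F : subvs_of W -> V) : (forall r, F r != 0 -> r \in D) ->
  \sum_(r \in [set: subvs_of W]) F r = \sum_(r <- D) F r.
Proof.
move=> FD; rewrite -(fsbig_widen [set` D] setT)//.
  by rewrite fsbig_finite//= set_fsetK.
move=> r [_ /= rD]; apply/eqP/negPn/negP => /FD; exact: rD.
Qed.

Lemma fssumE {V : lmodType R} (D : {fset subvs_of W}) (g : subvs_of W -> V) s :
  (forall r, s r != 0 -> r \in D) -> fssum g s = \sum_(r <- D) s r *: g r.
Proof.
move=> sD; apply: fsbig_fset_widen => r; apply: contraNT => /(contraNN (sD r)).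
by rewrite negbK => /eqP->; rewrite scale0r.
Qed.

Lemma fssum_linear {V : lmodType R} (g : subvs_of W -> V) : linear (fssum g).
Proof.
move=> a s t; pose D := (fssupp s `|` fssupp t)%fset.
have sD r : s r != 0 -> r \in D by move=> sr; rewrite inE fssuppP.
have tD r : t r != 0 -> r \in D by move=> tr; rewrite inE (fssuppP tr) orbT.
rewrite (fssumE g sD) (fssumE g tD) (fssumE (D := D)); last first.
  move=> r; apply: contraNT => /[dup] /(contraNN (sD r)) + /(contraNN (tD r)).
  rewrite !negbK => /eqP sr /eqP tr.
  by rewrite [_ r](_ : _ = a * s r + t r)// sr tr mulr0 addr0.
rewrite scaler_sumr -big_split; apply: eq_bigr => r _ /=.
by rewrite [X in X *: _](_ : _ = a * s r + t r)// scalerDl scalerA.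
Qed.

HB.instance Definition _ {V : lmodType R} (g : subvs_of W -> V) :=
  GRing.isLinear.Build R (finsupp_fun W) V *:%R (fssum g) (fssum_linear g).

Lemma fssum_comp {V V' : lmodType R} (h : {linear V -> V'})
  (g : subvs_of W -> V) s : h (fssum g s) = fssum (h \o g) s.
Proof.
rewrite !(fssumE _ (@fssuppP s)) linear_sum; apply: eq_bigr => r _.
by rewrite linearZ.
Qed.

Lemma delta_fin_supp r : (fun r' => (r' == r)%:R) \in @fin_supp R q W.
Proof.
apply/fin_suppP; apply: sub_finite_set (finite_set1 r) => r' /=.
by have [//|_] := eqVneq r' r; rewrite eqxx.
Qed.

Definition fsdelta r : finsupp_fun W := FinsuppFun (delta_fin_supp r).

Lemma fsdelta_sum {V : lmodType R} (g : subvs_of W -> V) r :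
  fssum g (fsdelta r) = g r.
Proof.
rewrite (fssumE (D := [fset r]%fset)).
  by rewrite big_seq_fset1 /= eqxx scale1r.
by move=> r' /=; rewrite inE; have [//|_] := eqVneq r' r; rewrite eqxx.
Qed.

Definition fscoef r s : R^o := s r.

Lemma fscoef_linear r : linear (fscoef r).
Proof. by []. Qed.

HB.instance Definition _ r := GRing.isLinear.Build R (finsupp_fun W) R^o *:%R
  (fscoef r) (fscoef_linear r).

Lemma fssum_fsdelta s : fssum fsdelta s = s.
Proof.
apply/val_inj/funext => r /=.
rewrite (fssumE _ (@fssuppP s)).
rewrite -[LHS]/(fscoef r _) linear_sum.
have [sr|] := boolP (r \in fssupp s).
  rewrite (big_fsetD1 r)//= big1_fset ?addr0; last first.
    move=> r'; rewrite !inE => /andP[r'r _] _.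
    by rewrite [LHS](_ : _ = s r' * (r == r')%:R)// eq_sym (negPf r'r) mulr0.
  by rewrite [LHS](_ : _ = s r * (r == r)%:R)// eqxx mulr1.
move=> /(contraNN (@fssuppP s r)); rewrite negbK => /eqP sr.
rewrite big1_seq ?sr// => r' /andP[_ r's].
rewrite [LHS](_ : _ = s r' * (r == r')%:R)//.
have [rr'|_] := eqVneq r r'; last by rewrite mulr0.
by rewrite -rr' sr mul0r.
Qed.

Lemma normHE s :
  normH s = `|s 0| + \sum_(r <- fssupp s) enorm (vsval r) * `|s r|.
Proof.
rewrite /normH; congr (_ + _).
transitivity (\sum_(r \in [set: subvs_of W]) enorm (vsval r) * `|s r|).
  apply: fsbig_widen => // r [_ /= /contrapT ->].
  by rewrite linear0 enorm0 mul0r.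
apply: fsbig_fset_widen => r h; apply: fssuppP.
by apply: contraNN h => /eqP->; rewrite normr0 mulr0.
Qed.

(** Continuity of [fssum g] for [normH], thanks to the weights [enorm (vsval r)] in that norm. *)
Lemma fssum_le_normH (g : subvs_of W -> R^o) (C : R) s : 0 <= C ->
  (forall r, `|g r| <= C * enorm (vsval r)) -> `|fssum g s : R| <= C * normH s.
Proof.
move=> C0 gC; rewrite (fssumE _ (@fssuppP s)) normHE mulrDr.
apply: le_trans (ler_norm_sum _ _ _) _.
rewrite mulr_sumr; apply: ler_wpDl; first exact: mulr_ge0.
apply: ler_sum => r _; rewrite normrM mulrA mulrC.
by rewrite ler_wpM2r.
Qed.

(** At [r = 0] the weight vanishes, and it is the separate term [|s 0|] of the norm that bounds the
    coefficient. *)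
Lemma coef_le_normH r : exists C : R, forall s, `|s r| <= C * normH s.
Proof.
have sum0 s : 0 <= \sum_(r' <- fssupp s) enorm (vsval r') * `|s r'|.
  by apply: sumr_ge0 => r' _; rewrite mulr_ge0 ?enorm_ge0.
have [->|r0] := eqVneq r 0.
  by exists 1 => s; rewrite mul1r normHE lerDl.
have e0 : 0 < enorm (vsval r).
  rewrite lt_def enorm_ge0 andbT; apply: contraNN r0 => /eqP/enorm_eq0 h.
  by apply/eqP/val_inj; rewrite /= h.
exists (enorm (vsval r))^-1 => s; rewrite ler_pdivlMl// normHE.
apply: ler_wpDl => //.
have [sr|] := boolP (r \in fssupp s).
  rewrite (big_fsetD1 r)//= lerDl; apply: sumr_ge0 => r' _.
  by rewrite mulr_ge0 ?enorm_ge0.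
move=> /(contraNN (@fssuppP s r)); rewrite negbK => /eqP->.
by rewrite normr0 mulr0.
Qed.

Lemma normH_fsdelta r : r != 0 -> normH (fsdelta r) = enorm (vsval r).
Proof.
move=> r0; rewrite normHE /= eq_sym (negPf r0) normr0 add0r.
have -> : fssupp (fsdelta r) = [fset r]%fset.
  apply/fsetP => r'; apply/idP/idP => [|]; last first.
    by rewrite inE => /eqP->; apply: fssuppP; rewrite /= eqxx oner_eq0.
  rewrite in_fset_set; last exact/fin_suppP/coef_fin_supp.
  by move=> /set_mem/=; rewrite inE; have [//|_] := eqVneq r' r; rewrite eqxx.
by rewrite big_seq_fset1 /= eqxx normr1 mulr1.
Qed.

End FinSuppSums.

(** * Closures of convex hulls *)

Section ClosedHulls.
Context {R : realType}.

Lemma closure_normP (V : normedModType R) (A : set V) s :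
  closure A s <-> forall e : R, 0 < e -> exists2 t, A t & `|s - t| < e.
Proof.
split=> [As e e0|As U /nbhs_ballP[e /= e0 eU]].
  have [t [At]] := As _ (nbhsx_ballx s e e0).
  by rewrite -ball_normE/=; exists t.
have [t At st] := As e e0; exists t; split=> //; apply: eU.
by rewrite -ball_normE.
Qed.

Lemma convex_hull_convex (M : lmodType R) (A : set M) :
  convex_set (convex_hull A).
Proof.
apply/convex_setP => x y t Ax Ay t0 t1 B [Bc AB].
by apply: (convex_setP _).1 => //; [apply: Ax|apply: Ay].
Qed.

Lemma convex_hull_ge (M : lmodType R) (l : {linear M -> R^o}) (c : R)
    (A : set M) : (forall t, A t -> c <= l t) ->
  forall t, convex_hull A t -> c <= l t.
Proof.
move=> Ac; apply: smallest_sub => //; apply/convex_setP => x y t /= cx cy t0 t1.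
by rewrite linearD !linearZ/= /GRing.scale/=; nra.
Qed.

Lemma closure_hull_ge (V : normedModType R) (l : {linear V -> R^o}) (c C : R)
    (A : set V) s : (forall t, A t -> c <= l t) ->
  (forall t, `|l t : R| <= C * `|t|) -> closure (convex_hull A) s -> c <= l s.
Proof.
move=> Ac lC /closure_normP As; rewrite leNgt; apply/negP => sc.
(* [C] may be zero or negative; [|C| + 1] is a positive Lipschitz constant. *)
pose e : R := (c - l s) / (`|C| + 1).
have C1 : 0 < `|C| + 1 by rewrite ltr_wpDl.
have e0 : 0 < e by rewrite divr_gt0// subr_gt0.
have [t At st] := As e e0.
have ct := convex_hull_ge Ac At.
have : `|l (s - t) : R| < c - l s.
  apply: le_lt_trans (lC _) _.
  apply: (@le_lt_trans _ _ ((`|C| + 1) * `|s - t|)).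
    by apply: ler_wpM2r => //; have := ler_norm C; lra.
  by rewrite mulrC -ltr_pdivlMr.
by rewrite linearB ltr_norml => /andP[+ _]; rewrite opprB ltrBrDl; lra.
Qed.

Lemma closure_separation (V : normedModType R) (A : set V) s :
  convex_set A -> A !=set0 -> ~ closure A s ->
  exists (l : {scalar V}) (a D : R), [/\ l s < a, forall t, A t -> a <= l t,
    0 <= D & forall t, l t <= D * `|t|].
Proof.
move=> /convex_setP Ac [c0 Ac0] /closure_normP As.
have [e e0 se] : exists2 e : R, 0 < e & forall t, A t -> e <= `|s - t|.
  apply: contrapT => h; apply: As => e e0; apply: contrapT => h'.
  apply: h; exists e => // t At; rewrite leNgt; apply/negP => st.
  by apply: h'; exists t.
(* [K] is the open [e]-neighbourhood of [c0 - A]. It contains a ball about 0, and [c0 - s] is not in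
   it. *)
pose K := [set x | exists2 c, A c & `|x - (c0 - c)| < e].
pose b (x : V) : R := e / (1 + `|x|).
have n0 (x : V) : 0 < 1 + `|x| by rewrite ltr_pwDl.
have b0 x : 0 < b x by rewrite divr_gt0.
have bx x : `|b x *: x| < e.
  rewrite normrZ gtr0_norm// /b mulrAC -mulrA gtr_pMr//.
  by rewrite mulrC ltr_pdivrMl// mulr1 ltrDr.
have [| | |l [lK lz]] := @gauge_separation R V K (c0 - s).
- move=> x y t [c Acc xc] [d Ad yd] t0 t1.
  exists (t *: c + (1 - t) *: d); first exact: Ac.
  have zm (a1 a2 b1 b2 d1 d2 : V) :
      a1 + a2 - (b1 + b2 - (d1 + d2)) = a1 - (b1 - d1) + (a2 - (b2 - d2)).
    by rewrite (opprD d1) (addrACA b1) (opprD (b1 - d1)) addrACA.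
  have {1}-> : c0 = t *: c0 + (1 - t) *: c0.
    by rewrite -scalerDl addrC subrK scale1r.
  rewrite zm -!scalerBr.
  apply: le_lt_trans (ler_normD _ _) _; rewrite !normrZ ger0_norm//.
  rewrite ger0_norm ?subr_ge0//.
  have [->|tn0] := eqVneq t 0; first by rewrite mul0r add0r subr0 mul1r.
  have t0' : 0 < t by rewrite lt_neqAle eq_sym tn0.
  by nra.
- move=> x; exists (b x); split=> //; exists c0 => //.
  by rewrite subrr subr0.
- move=> c c1 [t At] tc; have c_gt0 : 0 < c by exact: lt_trans c1.
  have ci1 : c^-1 <= 1 by rewrite invf_le1// ltW.
  have ci0 : 0 <= c^-1 by rewrite invr_ge0 ltW.
  (* If [c *: (c0 - s)] were within [e] of [c0 - t], then [s] would be within [e] of a convex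
     combination of [t] and [c0]. *)
  have := se _ (Ac _ _ _ At Ac0 ci0 ci1); rewrite leNgt => /negP; apply.
  have -> : s - (c^-1 *: t + (1 - c^-1) *: c0) =
      - (c^-1 *: (c *: (c0 - s) - (c0 - t))).
    rewrite scalerBr scalerA mulVf ?gt_eqF// scale1r scalerBr scalerBl scale1r.
    by rewrite !opprB opprD opprB addrA addrACA [RHS]addrACA [s + _]addrC.
  rewrite normrN normrZ ger0_norm//; apply: le_lt_trans tc.
  by rewrite ler_piMl.
have lA t w : A t -> `|w| < e -> l s + l w <= l t.
  move=> At we; have : K (c0 - t + w).
    by exists t => //; rewrite addrAC subrr add0r.
  by move=> /lK; move: lz; rewrite !linearD !linearN/=; lra.
(* The ball of radius [e] leaves room to move [s] a little towards [c0], a direction in which [l] is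
   at least 1; this makes the separation strict. As [l <= 1] on that ball, scaling [t] to norm
   [e / 2] gives the bound [2 / e]. *)
exists l, (l s + b (c0 - s) * l (c0 - s)), (2 / e); split.
- by rewrite ltrDl mulr_gt0// (lt_le_trans _ lz).
- by move=> t At; have := lA t _ At (bx (c0 - s)); rewrite linearZ.
- by rewrite divr_ge0// ltW.
move=> t; have [->|t0] := eqVneq t 0; first by rewrite linear0 normr0 mulr0.
have nt : 0 < `|t| by rewrite normr_gt0.
have te : `|(e / 2 / `|t|) *: t| < e.
  rewrite normrZ gtr0_norm ?divr_gt0//.
  by rewrite divfK ?gt_eqF//; lra.
have : K (c0 - c0 + (e / 2 / `|t|) *: t).
  by exists c0 => //; rewrite addrAC subrr add0r.
move=> /lK; rewrite subrr add0r linearZ/= -ler_pdivlMl ?divr_gt0// mulr1.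
by rewrite !invf_div [2 / e * _]mulrC.
Qed.

End ClosedHulls.

(** * Validity of the inequalities *)

Section DotLinear.
Context {R : realType} {q : nat}.

Lemma dot_linear (a : 'rV[R]_q) : linear (dot a : 'rV[R]_q -> R^o).
Proof. by move=> t x y; rewrite dotDr dotZr. Qed.

Lemma dotNl (a x : 'rV[R]_q) : dot (- a) x = - dot a x.
Proof. by rewrite /dot -sumrN; apply: eq_bigr => i _; rewrite mxE mulNr. Qed.

HB.instance Definition _ (a : 'rV[R]_q) :=
  GRing.isLinear.Build R 'rV[R]_q R^o *:%R (dot a) (dot_linear a).

End DotLinear.

Section ValidInequalities.
Context {R : realType} {q : nat} (f : 'rV[R]_q) (W : {vspace 'rV[R]_q}).
Implicit Types (s t : finsupp_fun W) (r : subvs_of W) (B : set 'rV[R]_q).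
Local Notation T := (translate f W).
Local Notation L := (T `&` integer_points).

Lemma endpointE s : endpoint f s = f + vsval (fssum id s).
Proof. by rewrite fssum_comp. Qed.

Lemma translate_endpoint s : T (endpoint f s).
Proof. by rewrite endpointE; exact: translate_base. Qed.

Lemma dot_endpoint (a : 'rV[R]_q) s :
  dot a (endpoint f s - f) = fssum (fun r => dot a (vsval r) : R^o) s.
Proof.
rewrite /endpoint addrAC subrr add0r.
exact: (fssum_comp (dot a : {linear 'rV[R]_q -> R^o}) vsval s).
Qed.

Lemma fssum_le (g h : subvs_of W -> R^o) s : (forall r, 0 <= s r) ->
  (forall r, g r <= h r :> R) -> (fssum g s <= fssum h s :> R).
Proof.
move=> s0 gh; rewrite !(fssumE _ (@fssuppP _ _ _ s)).
by apply: ler_sum => r _; exact: ler_wpM2l.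
Qed.

Lemma max_form_bound n (a : 'I_n.+1 -> 'rV[R]_q) : exists2 C : R, 0 <= C &
  forall r, `|max_form a r| <= C * enorm (vsval r).
Proof.
pose C : R := \sum_i \sum_j `|a i 0 j|.
have C0 : 0 <= C by do 2!(apply: sumr_ge0 => ? _).
have aC i r : `|dot (a i) (vsval r)| <= C * enorm (vsval r).
  apply: le_trans (dot_le_enorm _ _) _.
  apply: ler_wpM2r; first exact: enorm_ge0.
  by rewrite /C (bigD1 i)//= lerDl; do 2!(apply: sumr_ge0 => ? _).
exists C => // r; rewrite ler_norml; apply/andP; split.
  apply: le_trans (le_max_form a ord0 r).
  by have := aC ord0 r; rewrite ler_norml => /andP[].
by apply: max_form_le => i; have := aC i r; rewrite ler_norml => /andP[].
Qed.

Lemma psi_valid B t : BW f W B -> Rf f W t ->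
  (1 <= fssum (psi f W B : subvs_of W -> R^o) t :> R).
Proof.
move=> BB [t0 ti]; have Lt : L (endpoint f t).
  by split=> //; exact: translate_endpoint.
have [|n [a [[BE _] ->]]] := psi_max_form _ BB; first by exists (endpoint f t).
have [Bl Bf] := BB; have [[BT Bc _] _] := Bl.
have [i ai] : exists i, 1 <= dot (a i) (endpoint f t - f).
  apply: contrapT => na.
  have lt i : dot (a i) (endpoint f t - f) < 1.
    by rewrite ltNge; apply/negP => ?; apply: na; exists i.
  (* If all forms are below 1 at the lattice point [x], so is their maximum [m], and [B] reaches
     beyond [x]: [e] is chosen such that [(1 + e) * m <= 1], the case split covering small and
     negative [m]. *)
  pose x := endpoint f t; pose m := max_form a (vsproj W (x - f)).
  have xfW : x - f \in W by apply/translateP; exact: Lt.1.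
  have m1 : m < 1.
    rewrite /m /max_form vsprojK//; apply: bigmax_lt => //.
  pose e : R := if m <= 2^-1 then 1 else m^-1 - 1.
  have e0 : 0 < e.
    rewrite /e; case: (lerP m 2^-1) => hm; first exact: ltr01.
    by rewrite subr_gt0 invf_gt1//; lra.
  have em : (1 + e) * m <= 1.
    rewrite /e; case: (lerP m 2^-1) => hm; first by lra.
    by rewrite addrC subrK mulVf// gt_eqF//; lra.
  have := (lattice_freeP BT Bc Bf).1 Bl.1 x e Lt e0; apply.
  rewrite BE; split=> [|i _]; first exact: translate_ray Lt.1.
  rewrite addrAC dotDr dotZr.
  have mi : dot (a i) (x - f) <= m.
    by rewrite -[x - f](vsprojK xfW); exact: le_max_form.
  by apply: le_trans em; nra.
apply: le_trans ai _; rewrite dot_endpoint; apply: fssum_le => // r.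
exact: le_max_form.
Qed.

Lemma closure_Rf_sub s : L !=set0 -> closure (convex_hull (Rf f W)) s ->
  [/\ Vcal f W s,
      forall B, BW f W B ->
        (1 <= fssum (psi f W B : subvs_of W -> R^o) s :> R)
    & forall r, 0 <= s r].
Proof.
move=> [x0 Lx0] cs; split.
- have V0 : Vaff f W x0 by exact: sub_gen_smallest.
  have [K KP] := affine_set_equations (@affine_hull_affine _ _ _) V0.
  have KE x j : ((x - x0) *m K) 0 j =
      dot (col j K)^T (x - f) + dot (col j K)^T (f - x0).
    rewrite -dotDr addrA subrK mxE; apply: eq_bigr => i _.
    by rewrite !mxE mulrC.
  apply/KP/rowP => j; rewrite KE mxE.
  pose k := (col j K)^T; pose c := dot k (f - x0).
  have Rk t : Rf f W t -> dot k (endpoint f t - f) = - c.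
    move=> [_ ti]; apply/eqP; rewrite -addr_eq0 -KE.
    have /KP-> : Vaff f W (endpoint f t); last by rewrite mxE.
    by apply: sub_gen_smallest; split=> //; exact: translate_endpoint.
  have ge u (d : R) : (forall t, Rf f W t -> d <= dot u (endpoint f t - f)) ->
      d <= dot u (endpoint f s - f).
    move=> du; pose C := \sum_i `|u 0 i|.
    have C0 : 0 <= C by apply: sumr_ge0.
    rewrite dot_endpoint; apply: (closure_hull_ge (C := C)) cs => t.
      by move=> Rt; have := du t Rt; rewrite dot_endpoint.
    rewrite finsupp_normE; apply: fssum_le_normH => // r.
    exact: dot_le_enorm.
  (* The equation is split into two inequalities, for [k] and for [- k], each of which survives the
     closure. *)
  apply/eqP; rewrite addr_eq0 eq_le -/k -/c ge ?andbT; last first.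
    by move=> t /Rk ->.
  rewrite -lerN2 opprK -dotNl; apply: ge => t /Rk.
  by rewrite dotNl => ->; rewrite opprK.
- move=> B BB.
  have [n [a [_ psiE]]] : exists n (a : 'I_n.+1 -> 'rV[R]_q),
      irredundant_repr f W B a /\ psi f W B = max_form a.
    by apply: psi_max_form => //; exists x0.
  have [C C0 aC] := max_form_bound a.
  apply: (closure_hull_ge (C := C)) cs => [t|t]; first exact: psi_valid.
  by rewrite finsupp_normE; apply: fssum_le_normH => // r; rewrite psiE.
- move=> r; have [C sC] := @coef_le_normH _ _ _ r.
  rewrite -[s r]/(fscoef r s); apply: (closure_hull_ge (C := C)) cs => t.
    by move=> [t0 _]; exact: t0.
  by rewrite finsupp_normE; exact: sC.
Qed.

End ValidInequalities.

(** * Sufficiency of the inequalities *)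

Section MaximalExtension.
Context {R : realType} {q : nat} (f : 'rV[R]_q) (W : {vspace 'rV[R]_q}).
Implicit Types (B C X : set 'rV[R]_q).
Local Notation T := (translate f W).
Local Notation L := (T `&` integer_points).

Lemma rel_interior_sub B C x : B `<=` C -> C `<=` T ->
  rel_interior f W B x -> rel_interior f W C x.
Proof.
move=> BC CT /(rel_interiorP _ (subset_trans BC CT))[Tx [d d0 dB]].
by apply/rel_interiorP => //; split=> //; exists d => // w /dB /BC.
Qed.

Lemma maximal_extension B : lattice_free_convex f W B ->
  rel_interior f W B f -> exists2 C, BW f W C & B `<=` C.
Proof.
move=> Bl Bf.
have [BT _ _] := Bl.
have lfint X : lattice_free_convex f W (B `|` X) ->
    rel_interior f W (B `|` X) f.
  by move=> [XT _ _]; exact: rel_interior_sub Bf.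
(* Adjoining [B] to every set makes the empty chain, whose union is empty, harmless. *)
have [|A [Al Amax]] :=
    @Zorn_bigcup _ [set X | lattice_free_convex f W (B `|` X)].
  move=> F Flf Ftot /=; set U := B `|` _.
  (* Any two points of the union lie in one lattice-free convex set [B] with [Z] adjoined, so
     convexity and lattice-freeness are inherited. *)
  have UP x y : U x -> U y -> exists Z,
      [/\ lattice_free_convex f W (B `|` Z), B `|` Z `<=` U,
       (B `|` Z) x & (B `|` Z) y].
    have sub X : F X -> B `|` X `<=` U.
      by move=> FX z [Bz|Xz]; [left|right; exists X].
    move=> [Bx|[X FX Xx]] [By|[Y FY Yy]].
    - by exists set0; rewrite setU0; split=> // z; left.
    - by exists Y; split; [exact: Flf|exact: sub|left|right].
    - by exists X; split; [exact: Flf|exact: sub|right|left].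
    - have [XY|YX] := Ftot _ _ FX FY.
        by exists Y; split; [exact: Flf|exact: sub|right; exact: XY|right].
      by exists X; split; [exact: Flf|exact: sub|right|right; exact: YX].
  have UT : U `<=` T.
    by move=> x Ux; have [Z [[ZT _ _] _ Zx _]] := UP x x Ux Ux; exact: ZT.
  have Uc : convex_set U.
    apply/convex_setP => x y t Ux Uy t0 t1.
    have [Z [[_ /convex_setP Zc _] ZU Zx Zy]] := UP x y Ux Uy.
    by apply: ZU; exact: Zc.
  have Uf : rel_interior f W U f.
    by apply: rel_interior_sub Bf => // z; left.
  apply/lattice_freeP => // x e Lx e0 Ue.
  have [Z [Zl _ Ze _]] := UP _ _ Ue Ue; have [ZT Zc _] := Zl.
  exact: (lattice_freeP ZT Zc (lfint _ Zl)).1 Zl x e Lx e0 Ze.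
exists (B `|` A); last by move=> z; left.
split; last exact: lfint.
split=> // C Cl BAC.
have BC : B `|` C = C by apply/setUidPr => z Bz; apply: BAC; left.
have AC : A `<=` C by move=> z Az; apply: BAC; right.
have CA : C `<=` A.
  apply: contrapT => nCA; apply: (Amax C) => /=; last by rewrite BC.
  by split.
by apply/seteqP; split=> // z /CA; right.
Qed.

End MaximalExtension.

(** * Sublinear functions certifying a point outside the closed hull *)

Section Certificate.
Context {R : realType} {q : nat} (f : 'rV[R]_q) (W : {vspace 'rV[R]_q}).
Implicit Types (s t : finsupp_fun W) (r v w : subvs_of W).
Local Notation T := (translate f W).
Local Notation L := (T `&` integer_points).
Local Notation V := (Vaff f W).

Lemma scalar_fssum (l : {scalar finsupp_fun W}) s :
  l s = fssum (fun r => l (fsdelta r) : R^o) s.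
Proof.
rewrite -{1}(fssum_fsdelta s) !(fssumE _ (@fssuppP _ _ _ s)) linear_sum.
by apply: eq_bigr => r _; rewrite linearZ.
Qed.

Lemma scalar_fssum_id (l : {scalar subvs_of W}) s :
  l (fssum id s) = fssum (fun r => l r : R^o) s.
Proof.
rewrite !(fssumE _ (@fssuppP _ _ _ s)) linear_sum.
by apply: eq_bigr => r _; rewrite linearZ.
Qed.

Lemma Rf_fssum s : (forall r, 0 <= s r) ->
  L (f + vsval (fssum id s)) -> Rf f W s.
Proof. by move=> s0 [_ si]; split=> //; rewrite endpointE. Qed.

Lemma sublinear_certificate s : L !=set0 -> (forall r, 0 <= s r) ->
  ~ closure (convex_hull (Rf f W)) s ->
  exists (p : subvs_of W -> R) (a C : R), [/\ sublinear p,
    0 <= C /\ forall r, p r <= C * enorm (vsval r),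
    forall x, L x -> a <= p (vsproj W (x - f))
    & (fssum (p : subvs_of W -> R^o) s < a :> R)].
Proof.
move=> [x0 Lx0] s0 ns.
have [|l [a [D [sa la D0 lD]]]] :=
    closure_separation (convex_hull_convex (A := Rf f W)) _ ns.
  exists (fsdelta (vsproj W (x0 - f))); apply: sub_gen_smallest.
  apply: Rf_fssum => [r|]; first by rewrite /= ler0n.
  by rewrite fsdelta_sum translateE//; exact: Lx0.1.
have {}la t : Rf f W t -> a <= l t.
  by move=> Rt; apply: la; exact: sub_gen_smallest.
pose E r (c : R) := exists t : finsupp_fun W,
  [/\ forall r', 0 <= t r', fssum id t = r & l t <= c].
have ED x y c d : E x c -> E y d -> E (x + y) (c + d).
  move=> [t [t0 tx tc]] [u [u0 uy ud]]; exists (t + u); split.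
  - by move=> r; exact: (addr_ge0 (t0 r) (u0 r)).
  - by rewrite linearD/= tx uy.
  - by rewrite linearD; exact: lerD.
have EZ (b : R) x c : 0 < b -> E x c -> E (b *: x) (b * c).
  move=> b0 [t [t0 tx tc]]; exists (b *: t); split.
  - by move=> r; exact: (mulr_ge0 (ltW b0) (t0 r)).
  - by rewrite linearZ/= tx.
  - by rewrite linearZ/= ler_pM2l.
have Edelta r : E r (l (fsdelta r)).
  by exists (fsdelta r); split=> //; exact: fsdelta_sum.
have Eex r : exists c, E r c by eexists; exact: Edelta.
(* Adding multiples of [t] to [d] does not move the endpoint, so the sum stays in [Rf]. If
   [l t < 0], the multiple [b] brings [l] down to at most [a - 1]. *)
have E0 c : E 0 c -> 0 <= c.
  move=> [t [t0 tz tc]]; apply: le_trans tc; rewrite leNgt; apply/negP => lt0.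
  pose d := fsdelta (vsproj W (x0 - f)).
  pose b : R := (`|l d - a| + 1) / - l t.
  have b0 : 0 <= b by rewrite divr_ge0 ?addr_ge0// oppr_ge0 ltW.
  have : a <= l (d + b *: t).
    apply/la/Rf_fssum => [r|].
      by apply: (addr_ge0 (ler0n _ _) (mulr_ge0 b0 (t0 r))).
    rewrite linearD linearZ/= tz scaler0 addr0 fsdelta_sum translateE//.
    exact: Lx0.1.
  rewrite linearD linearZ/= /b invrN mulrN mulNr divfK ?lt_eqF//.
  by have := ler_norm (l d - a); lra.
have ps := epi_inf_sublinear ED EZ Eex E0.
exists (epi_inf E), a, D; split=> //.
(* The case [r = 0] is separate because [fsdelta 0] has norm 1, not [enorm 0]. *)
- split=> // r; have [->|r0] := eqVneq r 0.
    by rewrite (sublinear0 ps) mulr_ge0 ?enorm_ge0.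
  apply: le_trans (epi_inf_le ED Eex E0 (Edelta r)) _.
  by have := lD (fsdelta r); rewrite finsupp_normE normH_fsdelta.
- move=> x Lx; apply: le_epi_inf => // c [t [t0 tx tc]].
  apply: le_trans tc; apply/la/Rf_fssum => //.
  by rewrite tx translateE//; exact: Lx.1.
- apply: le_lt_trans sa; rewrite (scalar_fssum l); apply: fssum_le => // r.
  exact: epi_inf_le.
Qed.

Lemma integer_pointsD (x y : 'rV[R]_q) :
  integer_points x -> integer_points y -> integer_points (x + y).
Proof.
by move=> /mxOverP xi /mxOverP yi; apply/mxOverP => i j; rewrite mxE rpredD.
Qed.

(** The directions whose lines stay at bounded distance from the integral vectors of [W] are closed
    under linear combinations. They include [x - x0] for lattice points [x], since [b *: (x - x0)]
    can be rounded to the multiple by the floor of [b]. *)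
Lemma lattice_direction x0 v : L x0 -> V (x0 + vsval v) -> exists D : R,
  forall b : R,
  exists2 z, integer_points (vsval z) & `|vsval (b *: v - z)| <= D.
Proof.
move=> Lx0.
pose Q v := exists D : R, forall b : R,
  exists2 z, integer_points (vsval z) & `|vsval (b *: v - z)| <= D.
have QZ (c : R) u : Q u -> Q (c *: u).
  by move=> [D DP]; exists D => b; rewrite scalerA; exact: DP.
have QD u u' : Q u -> Q u' -> Q (u + u').
  move=> [D DP] [D' DP']; exists (D + D') => b.
  have [z zi zD] := DP b; have [z' zi' zD'] := DP' b.
  exists (z + z'); first by rewrite linearD; exact: integer_pointsD.
  rewrite scalerDr opprD addrACA linearD.
  by apply: le_trans (ler_normD _ _) _; exact: lerD.
suff : V `<=` [set x | T x /\ Q (vsproj W (x - x0))].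
  by move=> VQ /VQ[_]; rewrite addrC addKr vsvalK.
apply: smallest_sub => [x y t [Tx Qx] [Ty Qy]|x [Tx xi]].
  split; first by apply: translate_comb => //; rewrite addrC subrK.
  have -> : t *: x + (1 - t) *: y - x0 = t *: (x - x0) + (1 - t) *: (y - x0).
    by apply/rowP => i; rewrite !mxE; ring.
  by rewrite linearD !linearZ/=; apply: QD; exact: QZ.
split=> //; have xxW : x - x0 \in W.
  have -> : x - x0 = (x - f) - (x0 - f) by rewrite opprB addrA subrK.
  by rewrite rpredB//; apply/translateP => //; exact: Lx0.1.
exists `|x - x0| => b.
exists ((Num.floor b)%:~R *: vsproj W (x - x0)).
  rewrite linearZ/= vsprojK//; apply/mxOverP => i j; rewrite !mxE.
  rewrite rpredM ?intr_int// rpredB//; first exact: (mxOverP xi).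
  exact: (mxOverP Lx0.2).
rewrite -scalerBl linearZ/= vsprojK// normrZ ler_piMl//.
have := floor_le b; have := floorD1_gt b; rewrite intrD => ? ?.
by rewrite ger0_norm; lra.
Qed.

Lemma certificate_ge0 (p : subvs_of W -> R) (a C : R) x0 v : sublinear p ->
  0 <= C -> (forall r, p r <= C * enorm (vsval r)) ->
  (forall x, L x -> a <= p (vsproj W (x - f))) ->
  L x0 -> V (x0 + vsval v) -> 0 <= p v.
Proof.
move=> ps C0 pC pL Lx0 Vv.
have [D DP] := lattice_direction Lx0 Vv.
rewrite leNgt; apply/negP => pv.
pose u0 := vsproj W (x0 - f).
(* [M] bounds [p] on the rounding error [z - b *: v]; [b] is so large that [p (u0 + z)] would be at
   most [a - 1]. *)
pose M : R := C * (q%:R * D).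
pose b : R := (`|p u0 + M - a| + 1) / - p v.
have b0 : 0 <= b by rewrite divr_ge0 ?addr_ge0// oppr_ge0 ltW.
have [z zi zD] := DP b.
have : a <= p (u0 + z).
  have := pL (x0 + vsval z).
  have -> : vsproj W (x0 + vsval z - f) = u0 + z.
    by rewrite addrAC linearD/= vsvalK.
  apply; split; first exact: translate_vsval Lx0.1.
  exact: integer_pointsD Lx0.2 zi.
have -> : u0 + z = u0 + b *: v + (z - b *: v).
  by rewrite -addrA [b *: v + _]addrC subrK.
have h1 := ps.1 (u0 + b *: v) (z - b *: v).
have h2 := ps.1 u0 (b *: v).
have h3 : p (z - b *: v) <= M.
  apply: le_trans (pC _) _; rewrite ler_wpM2l//.
  apply: le_trans (enorm_le_norm _) _; rewrite ler_wpM2l//.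
  by rewrite -opprB linearN normrN.
have h4 : p (b *: v) = - (`|p u0 + M - a| + 1).
  by rewrite ps.2// /b invrN mulrN mulNr divfK// lt_eqF.
by have := ler_norm (p u0 + M - a); lra.
Qed.

(* Hahn-Banach is applied to [r |-> inf_v p (r + v)], [v] ranging over the
   directions of [V]: a linear functional below it vanishes on them, and so may
   be subtracted from [p]. *)
Lemma nonnegative_certificate s : L !=set0 -> (forall r, 0 <= s r) ->
  Vcal f W s -> ~ closure (convex_hull (Rf f W)) s ->
  exists (p : subvs_of W -> R) (C : R), [/\ sublinear p,
    forall r, 0 <= p r,
    0 < C /\ forall r, p r <= C * enorm (vsval r),
    forall x, L x -> 1 <= p (vsproj W (x - f))
    & (fssum (p : subvs_of W -> R^o) s < 1 :> R)].
Proof.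
move=> L0 s0 Vs ns; have [x0 Lx0] := L0.
have [p [a [C [ps [C0 pC] pL psa]]]] := sublinear_certificate L0 s0 ns.
have Vx0 : V x0 by exact: sub_gen_smallest.
have [VZ VD] := affine_direction (@affine_hull_affine _ _ _) Vx0.
pose N v := V (x0 + vsval v).
have NZ (b : R) v : N v -> N (b *: v) by move=> /(VZ b); rewrite /N linearZ.
have ND u v : N u -> N v -> N (u + v).
  by move=> Nu Nv; rewrite /N linearD; exact: VD.
have N0 : N 0 by rewrite /N linear0 addr0.
have pN v : N v -> 0 <= p v by exact: certificate_ge0 pC pL Lx0.
pose E r (c : R) := exists2 v, N v & p (r + v) <= c.
have ED x y c d : E x c -> E y d -> E (x + y) (c + d).
  move=> [v Nv vc] [w Nw wd]; exists (v + w); first exact: ND.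
  by rewrite addrACA; apply: le_trans (ps.1 _ _) _; exact: lerD.
have EZ (b : R) x c : 0 < b -> E x c -> E (b *: x) (b * c).
  move=> b0 [v Nv vc]; exists (b *: v); first exact: NZ.
  by rewrite -scalerDr ps.2 ?(ltW b0)// ler_pM2l.
have Eex r : exists c, E r c by exists (p (r + 0)), 0.
have E0 c : E 0 c -> 0 <= c.
  by move=> [v Nv]; rewrite add0r; apply: le_trans; exact: pN.
have [l [lp _]] := hahn_banach 0 (epi_inf_sublinear ED EZ Eex E0).
have {}lp r v : N v -> l r <= p (r + v).
  by move=> Nv; apply: le_trans (lp r) _; apply: epi_inf_le => //; exists v.
have lN v : N v -> l v = 0.
  move=> Nv; have := lp v (- v); have := lp (- v) v.
  rewrite addNr subrr (sublinear0 ps) linearN => h1 h2.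
  have := h1 Nv; have : N (- v) by rewrite -scaleN1r; exact: NZ.
  by move=> /h2; lra.
pose u0 := vsproj W (x0 - f).
(* Two points of [V] differ by a direction of [V], on which [l] vanishes; subtracting [l] thus
   lowers both sides of each inequality by the constant [l u0]. *)
have lE r : V (f + vsval r) -> l r = l u0.
  move=> Vr; apply/eqP; rewrite -subr_eq0 -linearB; apply/eqP/lN.
  rewrite /N linearB/= vsprojK; last by apply/translateP; exact: Lx0.1.
  by rewrite opprB addrC addrA subrK addrC.
pose p' r := p r - l r.
have p'0 r : 0 <= p' r.
  by rewrite subr_ge0; have := lp r 0 N0; rewrite addr0.
have p's : (fssum (p' : subvs_of W -> R^o) s =
    fssum (p : subvs_of W -> R^o) s - l u0 :> R).
  rewrite -(lE (fssum id s)); last by rewrite -endpointE.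
  rewrite (scalar_fssum_id l) !(fssumE _ (@fssuppP _ _ _ s)) -sumrB.
  by apply: eq_bigr => r _; rewrite /p' scalerBr.
pose a' := a - l u0.
have a'0 : 0 < a'.
  apply: (@le_lt_trans _ _ (fssum (p' : subvs_of W -> R^o) s)).
    rewrite (fssumE _ (@fssuppP _ _ _ s)); apply: sumr_ge0 => r _.
    by apply: mulr_ge0.
  by rewrite p's ltrD2r.
(* From [- l r <= p (- r)] follows the bound [2 * C]; the summand 1 makes the constant positive even
   if [C = 0]. *)
exists (fun r => p' r / a'), ((2 * C + 1) / a'); split.
- split=> [x y|b x b0].
    rewrite -mulrDl ler_pM2r ?invr_gt0// /p' linearD.
    by have := ps.1 x y; lra.
  by rewrite /p' linearZ/= ps.2// -mulrBr mulrA.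
- by move=> r; rewrite divr_ge0// ltW.
- split=> [|r]; first by rewrite divr_gt0//; lra.
  rewrite mulrAC ler_pM2r ?invr_gt0// /p'.
  have := lp (- r) 0 N0; rewrite addr0 linearN => h.
  have := pC (- r); have := pC r; rewrite linearN/= enormN.
  by have := enorm_ge0 (vsval r); lra.
- move=> x Lx; rewrite ler_pdivlMr// mul1r /p' lE ?lerD2r; first exact: pL.
  by rewrite translateE; [exact: sub_gen_smallest|exact: Lx.1].
- have -> : (fssum (fun r => p' r / a' : R^o) s =
      fssum (p' : subvs_of W -> R^o) s / a' :> R).
    rewrite !(fssumE _ (@fssuppP _ _ _ s)) mulr_suml.
    by apply: eq_bigr => r _; rewrite /GRing.scale/= mulrA.
  by rewrite ltr_pdivrMr// mul1r p's ltrD2r.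
Qed.

End Certificate.

(** * From a certificate to a maximal lattice-free set *)

Section CutGeneratingSet.
Context {R : realType} {q : nat} (f : 'rV[R]_q) (W : {vspace 'rV[R]_q}).
Implicit Types (s t : finsupp_fun W) (r v w : subvs_of W).
Local Notation T := (translate f W).
Local Notation L := (T `&` integer_points).

Lemma psi_le_sublinear (p : subvs_of W -> R) (C : R) : L !=set0 ->
  sublinear p -> (forall r, 0 <= p r) -> 0 < C ->
  (forall r, p r <= C * enorm (vsval r)) ->
  (forall x, L x -> 1 <= p (vsproj W (x - f))) ->
  exists2 B, BW f W B & forall r, psi f W B r <= p r.
Proof.
move=> L0 ps p0 C0 pC pL.
pose S := [set x | T x /\ p (vsproj W (x - f)) <= 1].
have ST : S `<=` T by move=> x [].
have Sc : convex_set S.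
  apply/convex_setP => x y t [Tx px] [Ty py] t0 t1; split.
    by apply: translate_comb => //; rewrite addrC subrK.
  have -> : t *: x + (1 - t) *: y - f = t *: (x - f) + (1 - t) *: (y - f).
    by apply/rowP => i; rewrite !mxE; ring.
  rewrite linearD !linearZ/=; apply: le_trans (ps.1 _ _) _.
  by rewrite !ps.2 ?subr_ge0//; nra.
have Sf : rel_interior f W S f.
  have Tf : T f by apply/translateP; rewrite subrr rpred0.
  apply/rel_interiorP => //; split=> //.
  (* The factor [q] compares the Euclidean norm with the sup norm; [q + 1] stays positive for
     [q = 0]. *)
  have Cq : 0 < C * (q%:R + 1) by rewrite mulr_gt0// ltr_wpDl.
  exists (C * (q%:R + 1))^-1; first by rewrite invr_gt0.
  move=> w; rewrite -[_^-1]mul1r ltr_pdivlMr// => wC.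
  split; first exact: translate_vsval.
  rewrite addrAC subrr add0r vsvalK; apply: le_trans (pC w) _.
  apply: le_trans (ltW wC); rewrite mulrCA ler_pM2l//.
  apply: le_trans (enorm_le_norm _) _; rewrite mulrC ler_wpM2l//; lra.
have Sl : lattice_free_convex f W S.
  apply/lattice_freeP => // x e Lx e0 [_].
  have -> : x + e *: (x - f) - f = (1 + e) *: (x - f).
    by apply/rowP => i; rewrite !mxE; ring.
  by rewrite linearZ/= ps.2 ?addr_ge0 ?(ltW e0)//; have := pL x Lx; nra.
have [B BB SB] := maximal_extension Sl Sf.
exists B => // r; have [n [a [[BE _] ->]]] := psi_max_form L0 BB.
(* Since [p r] may be 0, [r] is scaled by the inverse of [p r + e], which puts it into [S] and so
   into [B]. *)
apply: max_form_le => i; apply/ler_addgt0Pr => e e0.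
have pe : 0 < p r + e by rewrite ltr_wpDl.
have : S (f + vsval ((p r + e)^-1 *: r)).
  split; first exact: translate_base.
  rewrite addrAC subrr add0r vsvalK ps.2 ?invr_ge0 ?(ltW pe)//.
  by rewrite ler_pdivrMl// mulr1 lerDl ltW.
move=> /SB; rewrite BE => -[_ /(_ i isT)].
by rewrite addrAC subrr add0r /= dotZr ler_pdivrMl// mulr1.
Qed.

End CutGeneratingSet.

Theorem theorem4 (R : realType) (q : nat) (f : 'rV[R]_q)
    (W : {vspace 'rV[R]_q})
    (hfW : (translate f W `&` integer_points) !=set0) :
  closure (convex_hull (Rf f W)) =
  [set s : finsupp_fun W |
    [/\ Vcal f W s,
        forall B, BW f W B ->
          1 <= \sum_(r \in [set: subvs_of W]) psi f W B r * s r
      & forall r : subvs_of W, 0 <= s r]].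
Proof.
have psiE B (s : finsupp_fun W) :
    \sum_(r \in [set: subvs_of W]) psi f W B r * s r =
    fssum (psi f W B : subvs_of W -> R^o) s.
  by apply: eq_fsbigr => r _; rewrite mulrC.
apply/seteqP; split=> s /=.
  move=> /(closure_Rf_sub hfW)[Vs sB s0]; split=> // B BB.
  by rewrite psiE; exact: sB.
move=> [Vs sB s0]; apply: contrapT => ns.
have [p [C [ps p0 [C0 pC] pL]]] := nonnegative_certificate hfW s0 Vs ns.
have [B BB pB] := psi_le_sublinear hfW ps p0 C0 pC pL.
rewrite ltNge => /negP; apply; apply: le_trans (sB B BB) _.
by rewrite psiE; exact: fssum_le.
Qed.
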